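(* Suppose the measurement vector $a\in\mathbb R^d$ is mean zero, isotropic and sub-exponential, and the noise $\xi$ is a sub-exponential random variable. There exist absolute constants $c_1,c_2,c_3\ge 1$ such that the following holds. Let $\varepsilon\in(0,1)$, set $C_{a,\xi,R}=\max\{c_1(R\|a\|_{\psi_1}+\|\xi\|_{\psi_1}),1\}$, let $u\ge 0$, and suppose $$\lambda\ge 4C_{a,\xi,R}\cdot\log(64\,C_{a,\xi,R}\cdot\varepsilon^{-1}),\qquad m\ge c_2\lambda^2\log^2(\lambda m)\big[kn\log(ed)+k\log(2R)+k\log m+u\big]/\varepsilon^2 .$$ Then, with probability at least $1-c_3\exp(-u)$, simultaneously for all $x_0\in\mathbb R^k$ with $\|G(x_0)\|_2\le R$, any solution $\hat x_m$ of the empirical risk minimization problem $\min_{x\in\mathbb R^k}L(x)$ (where $L$ is built from the observations $y_i$ generated by $x_0$) satisfies $$\|G(\hat x_m)-G(x_0)\|_2\le\varepsilon .$$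
   Context: ReLU network: $G:\mathbb R^k\to\mathbb R^d$ is a fixed $n$-layer network without offsets, $G(x)=\sigma\circ(W_n\,\sigma\circ(W_{n-1}\cdots\sigma\circ(W_1x)))$, where $\sigma(t)=\max\{t,0\}$ is applied entrywise, $W_i\in\mathbb R^{d_i\times d_{i-1}}$, $d_0=k$, $d_n=d$, $d_i\le d$ for all $i\in\{1,\dots,n\}$, and $n<d$. Norms: for a real random variable $X$, $\|X\|_{\psi_1}=\sup_{p\ge1}p^{-1}(\mathbb E|X|^p)^{1/p}$; $X$ is sub-exponential if this is finite. A random vector $a\in\mathbb R^d$ is sub-exponential if $\|a\|_{\psi_1}:=\sup_{t\in\mathcal S^{d-1}}\|\langle a,t\rangle\|_{\psi_1}<\infty$. Isotropic means $\mathbb E[aa^\top]=\mathbf I_d$. Model: $R\ge1$ is a fixed number. $(a_i,\xi_i,\tau_i)$, $i=1,\dots,m$, are i.i.d. copies of $(a,\xi,\tau)$, where $a$, $\xi$, $\tau$ are independent and $\tau\sim\mathrm{Unif}[-\lambda,\lambda]$ with $\lambda>0$ a chosen parameter. For $x_0\in\mathbb R^k$ the observations are $y_i=\mathrm{sign}(\langle a_i,G(x_0)\rangle+\xi_i+\tau_i)$, and the empirical risk is $$L(x)=\|G(x)\|_2^2-\frac{2\lambda}{m}\sum_{i=1}^m y_i\langle a_i,G(x)\rangle .$$ ''Absolute constant'' means independent of all other quantities. *)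

(* Defs.v *)
From HB Require Import structures.
From mathcomp Require Import all_boot all_order all_algebra.
From mathcomp Require Import all_classical all_reals all_analysis.

Set Implicit Arguments.
Unset Strict Implicit.
Unset Printing Implicit Defensive.

Import Order.TTheory GRing.Theory Num.Theory.
Import numFieldNormedType.Exports.

Local Open Scope classical_set_scope.
Local Open Scope ring_scope.

Section euclidean.
Context {R : realType}.

Definition dot (d : nat) (u v : 'cV[R]_d) : R := \sum_(i < d) u i 0 * v i 0.

(* The library norm on matrices is the sup norm, hence this definition. *)
Definition norm2 (d : nat) (u : 'cV[R]_d) : R := Num.sqrt (dot u u).

(* Tuples, unlike matrices, carry the product Borel sigma-algebra in the
   library; random vectors are therefore tuple-valued. *)
Definition vec (d : nat) (t : d.-tuple R) : 'cV[R]_d := \col_i tnth t i.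

(* One-bit quantizer with values in {-1, 1}; unlike [Num.sg], it is 1 at 0. *)
Definition sign (t : R) : R := if 0 <= t then 1 else -1.

End euclidean.

Section network.
Context {R : realType}.

Definition relu (d : nat) (x : 'cV[R]_d) : 'cV[R]_d := map_mx (Num.max 0) x.

(* [w i] is the width d_i and [W i] is the matrix W_(i+1); only
   W 0, ..., W n.-1 enter the [n]-layer network.  The input dimension is [w 0]
   and the output dimension is [w n]. *)
Fixpoint relu_net (w : nat -> nat) (W : forall i, 'M[R]_(w i.+1, w i))
    (n : nat) (x : 'cV[R]_(w 0%N)) : 'cV[R]_(w n) :=
  match n with
  | 0 => x
  | n'.+1 => relu (W n' *m relu_net W n' x)
  end.

Definition one_bit (d : nat) (a : 'cV[R]_d) (xi tau : R) (g : 'cV[R]_d) : R :=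
  sign (dot a g + xi + tau).

Definition empirical_risk (k d m : nat) (G : 'cV[R]_k -> 'cV[R]_d) (lambda : R)
    (a : 'I_m -> 'cV[R]_d) (y : 'I_m -> R) (x : 'cV[R]_k) : R :=
  norm2 (G x) ^+ 2 -
  2 * lambda / m%:R * \sum_(i < m) y i * dot (a i) (G x).

Definition is_minimizer (V : Type) (L : V -> R) (x : V) : Prop :=
  forall z, L x <= L z.

End network.

Section probability.
Context {d : measure_display} {T : measurableType d} {R : realType}.
Variable P : probability T R.

Definition psi1_norm (X : T -> R) : \bar R :=
  ereal_sup [set ((p^-1)%:E * 'N[P]_(p%:E)[EFin \o X])%E
            | p in [set p : R | 1 <= p]].

Definition psi1_norm_vec (n : nat) (a : T -> n.-tuple R) : \bar R :=
  ereal_sup [set psi1_norm (fun w => dot (vec (a w)) t)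
            | t in [set t : 'cV[R]_n | norm2 t = 1]].

Definition subexponential (X : T -> R) : Prop := (psi1_norm X < +oo)%E.

Definition subexponential_vec (n : nat) (a : T -> n.-tuple R) : Prop :=
  (psi1_norm_vec a < +oo)%E.

Definition mean_zero (n : nat) (a : T -> n.-tuple R) : Prop :=
  forall i : 'I_n, ('E_P[fun w => (vec (a w) i 0)%R] = 0)%E.

Definition isotropic (n : nat) (a : T -> n.-tuple R) : Prop :=
  forall i j : 'I_n,
    ('E_P[fun w => (vec (a w) *m (vec (a w))^T)%R i j] =
     ((1%:M%R : 'M[R]_n) i j)%:E)%E.

Definition sigma_of d' (T' : measurableType d') (X : T -> T') : set (set T) :=
  preimage_set_system setT X measurable.

Definition mutually_independent (I : finType) (F : I -> set (set T)) : Prop :=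
  forall (J : {set I}) (A : I -> set T), (forall i, i \in J -> F i (A i)) ->
    fine (P (\bigcap_(i in [set` J]) A i)) = \prod_(i in J) fine (P (A i)).

(* The event [S] need not be measurable. *)
Definition with_probability_at_least (p : R) (S : set T) : Prop :=
  exists2 A : set T, measurable A /\ A `<=` S & (p%:E <= P A)%E.

End probability.

Definition same_law d1 d2 d' (T1 : measurableType d1) (T2 : measurableType d2)
    (T' : measurableType d') (R : realType)
    (P1 : probability T1 R) (P2 : probability T2 R)
    (X : T1 -> T') (Y : T2 -> T') : Prop :=
  forall S, measurable S -> P1 (X @^-1` S) = P2 (Y @^-1` S).

Definition triple (T A B C : Type) (X : T -> A) (Y : T -> B) (Z : T -> C) :
    T -> A * B * C :=
  fun w => (X w, Y w, Z w).

(* Main.v *)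
Require Import Defs.
From HB Require Import structures.
From mathcomp Require Import all_boot all_order all_algebra.
From mathcomp Require Import all_classical all_reals all_analysis.
From mathcomp Require Import measurable_realfun ring lra.

Set Implicit Arguments.
Unset Strict Implicit.
Unset Printing Implicit Defensive.

Import Order.TTheory GRing.Theory Num.Theory.
Import numFieldNormedType.Exports.

Local Open Scope classical_set_scope.
Local Open Scope ring_scope.

(** If [h = G xhat - G x0], minimality of [xhat] gives
    [|h|^2 <= 2 (lambda / m * \sum_i y_i <a_i, h> - <G x0, h>)].  The dither makes
    [lambda * E y <a, h>] equal to [<G x0, h>] up to the contribution of the event
    [|<a, G x0> + xi| > lambda], which the exponential moments make negligible.
    So it suffices to bound the deviation of the empirical average uniformly.

    [G] is piecewise linear with at most [(d + 1) ^ (k n)] pieces, because [p]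
    hyperplanes of [R^k] realise at most [(p + 1) ^ k] sign patterns.  Hence [G x0]
    ranges over few [k]-dimensional spaces and [h] over few [2k]-dimensional ones.
    For [h], a net of the unit sphere suffices as the deviation is a seminorm in
    [h].  For [G x0], a net of mesh [1 / (m d)] suffices: moving [G x0] to a net
    point [g] flips [y_i] only if [|<a_i, g> + xi_i + tau_i| <= |a_i| / (m d)], and
    conditionally on [(a_i, xi_i)] this has probability at most
    [|a_i| / (lambda m d)], so the total weight of the flipped measurements has a
    bounded exponential moment.  Nets are grids in orthonormal coordinates: the
    dimensional factor they lose is absorbed by [k n log (e d)].

    At fixed net points Chernoff's bound applies.  The variance of [y <a, h>] is
    that of [<a, h>], which is [|h|^2] by isotropy; [lambda >= 4 C log (64 C / eps)]
    makes the subexponential tail invisible at the scale [1 / lambda] of the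
    exponent. *)

(** * Euclidean geometry *)

Section euclidean_geometry.
Context {R : realType}.
Implicit Types d k q r : nat.

Lemma dotC d (u v : 'cV[R]_d) : dot u v = dot v u.
Proof. by apply: eq_bigr => i _; rewrite mulrC. Qed.

Lemma dotDr d (u v w : 'cV[R]_d) : dot u (v + w) = dot u v + dot u w.
Proof. by rewrite -big_split; apply: eq_bigr => i _; rewrite mxE mulrDr. Qed.

Lemma dotZr d c (u v : 'cV[R]_d) : dot u (c *: v) = c * dot u v.
Proof. by rewrite mulr_sumr; apply: eq_bigr => i _; rewrite mxE mulrCA. Qed.

Lemma dotZl d c (u v : 'cV[R]_d) : dot (c *: u) v = c * dot u v.
Proof. by rewrite dotC dotZr dotC. Qed.

Lemma dotBr d (u v w : 'cV[R]_d) : dot u (v - w) = dot u v - dot u w.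
Proof. by rewrite dotDr -scaleN1r dotZr mulN1r. Qed.

Lemma dot_ge0 d (u : 'cV[R]_d) : 0 <= dot u u.
Proof. by apply: sumr_ge0 => i _; rewrite -expr2 sqr_ge0. Qed.

Lemma dot_mulmx d (u v : 'cV[R]_d) : dot u v = (u^T *m v) 0 0.
Proof. by rewrite mxE; apply: eq_bigr => i _; rewrite mxE. Qed.

Lemma dot_eq0 d (u : 'cV[R]_d) : dot u u = 0 -> u = 0.
Proof.
move=> u0; apply/colP => i; rewrite !mxE; apply/eqP; rewrite -sqrf_eq0 expr2.
have /eqP := u0; rewrite psumr_eq0 => [/allP/(_ i)|j _]; last by rewrite -expr2 sqr_ge0.
by rewrite mem_index_enum => /(_ isT).
Qed.

Lemma norm2_ge0 d (u : 'cV[R]_d) : 0 <= norm2 u.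
Proof. exact: sqrtr_ge0. Qed.

Lemma sqr_norm2 d (u : 'cV[R]_d) : norm2 u ^+ 2 = dot u u.
Proof. by rewrite sqr_sqrtr // dot_ge0. Qed.

Lemma norm2_le_sqr d (u : 'cV[R]_d) c :
  0 <= c -> dot u u <= c ^+ 2 -> norm2 u <= c.
Proof. by move=> c0 uc; rewrite -(ger0_norm c0) -sqrtr_sqr ler_wsqrtr. Qed.

Lemma norm20 d : norm2 (0 : 'cV[R]_d) = 0.
Proof. by rewrite /norm2 -(scale0r 0) dotZr mul0r sqrtr0. Qed.

Lemma norm2_eq0 d (u : 'cV[R]_d) : norm2 u = 0 -> u = 0.
Proof. by move=> u0; apply: dot_eq0; rewrite -sqr_norm2 u0 expr0n. Qed.

Lemma norm2Z d c (u : 'cV[R]_d) : norm2 (c *: u) = `|c| * norm2 u.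
Proof.
by rewrite /norm2 dotZr dotC dotZr mulrA -expr2 sqrtrM ?sqr_ge0// sqrtr_sqr.
Qed.

Lemma norm2_sqrD d (u v : 'cV[R]_d) :
  norm2 (u + v) ^+ 2 = norm2 u ^+ 2 + 2 * dot u v + norm2 v ^+ 2.
Proof. by rewrite !sqr_norm2 dotDr ![dot (u + v) _]dotC !dotDr (dotC v u); ring. Qed.

Lemma cauchy_schwarz d (u v : 'cV[R]_d) : `|dot u v| <= norm2 u * norm2 v.
Proof.
have [/eqP u0|u0] := boolP (norm2 u == 0).
  by rewrite (norm2_eq0 u0) dotC -(scale0r 0) dotZr mul0r normr0 mulr_ge0 ?norm2_ge0.
(* This vector is |u|^2 times the component of v orthogonal to u; its squared norm is |u|^2 (|u|^2
   |v|^2 - <u, v>^2). *)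
have := dot_ge0 (norm2 u ^+ 2 *: v - dot u v *: u).
rewrite -sqr_norm2 -scaleNr norm2_sqrD !norm2Z dotZr dotZl !exprMn !real_normK ?num_real//.
move=> H; rewrite -(@ler_pXn2r _ 2)// ?nnegrE ?mulr_ge0 ?norm2_ge0// real_normK ?num_real//.
have p : 0 < norm2 u ^+ 2 by rewrite exprn_gt0 // lt0r u0 norm2_ge0.
rewrite -(ler_pM2l p) exprMn; move: H; rewrite (dotC v u); set a := norm2 u; set c := norm2 v; set e := dot u v; lra.
Qed.

Lemma norm2D d (u v : 'cV[R]_d) : norm2 (u + v) <= norm2 u + norm2 v.
Proof.
apply: norm2_le_sqr; first by rewrite addr_ge0 ?norm2_ge0.
rewrite -sqr_norm2 norm2_sqrD; have := cauchy_schwarz u v.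
by have := ler_norm (dot u v); rewrite sqrrD; lra.
Qed.

Lemma norm2N d (u : 'cV[R]_d) : norm2 (- u) = norm2 u.
Proof. by rewrite -scaleN1r norm2Z normrN1 mul1r. Qed.

Lemma coord_le_norm2 d (u : 'cV[R]_d) i : `|u i 0| <= norm2 u.
Proof.
rewrite -sqrtr_sqr ler_wsqrtr // /dot (bigD1 i) //= expr2 lerDl.
by apply: sumr_ge0 => j _; rewrite -expr2 sqr_ge0.
Qed.

Lemma norm2_le_sum d (u : 'cV[R]_d) : norm2 u <= \sum_i `|u i 0|.
Proof.
apply: norm2_le_sqr; first exact: sumr_ge0.
rewrite expr2 mulr_suml ler_sum // => i _.
rewrite (le_trans (ler_norm _)) // normrM ler_wpM2l // (bigD1 i) //= lerDl.
exact: sumr_ge0.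
Qed.

(** Induction on the columns: the first column is dropped when its residual against [U] vanishes,
    and otherwise the normalised residual joins [U]. Orthonormal coordinates make norms in the range
    of [A] computable in R^r. *)
Lemma gram_schmidt d q (A : 'M[R]_(d, q)) : exists r (U : 'M[R]_(d, r)),
  [/\ (r <= q)%N, U^T *m U = 1%:M & forall x : 'cV_q, exists c, A *m x = U *m c].
Proof.
elim: q A => [|q IH] A.
  exists 0%N, 0; split => // [|x]; first by apply/matrixP => -[].
  by exists 0; rewrite mulmx0 (flatmx0 x) mulmx0.
pose A' : 'M[R]_(d, 1 + q) := A; pose v : 'cV_d := lsubmx A'.
have [r [U [rq UU AU]]] := IH (rsubmx A').
have AE (x : 'cV_q.+1) : exists c, A *m x = v *m usubmx (x : 'cV[R]_(1 + q)) + U *m c.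
  have [c Ac] := AU (dsubmx (x : 'cV[R]_(1 + q))); exists c; rewrite -Ac.
  by rewrite -mul_row_col hsubmxK vsubmxK.
pose u := v - U *m (U^T *m v).
have vE : v = u + U *m (U^T *m v) by rewrite subrK.
have [u0|u0] := eqVneq u 0.
  exists r, U; split=> // [|x]; first exact: leqW.
  have [c ->] := AE x; exists (U^T *m v *m usubmx (x : 'cV[R]_(1 + q)) + c).
  by rewrite mulmxDr {1}vE u0 add0r !mulmxA.
have Uu : U^T *m u = 0.
  by rewrite mulmxBr (mulmxA U^T U) UU mul1mx subrr.
have nu : norm2 u != 0 by apply: contra_neq u0; exact: norm2_eq0.
pose e := (norm2 u)^-1 *: u.
have uE : u = norm2 u *: e by rewrite scalerA divff // scale1r.
exists (r + 1)%N, (row_mx U e); split => [||x]; first by rewrite addn1.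
  rewrite tr_row_mx mul_col_row UU scalar_mx_block; congr block_mx.
  - by rewrite -scalemxAr Uu scaler0.
  - by rewrite [_^T]linearZ /= -scalemxAl -(trmxK U) -trmx_mul Uu trmx0 scaler0.
  - apply/matrixP => i j; rewrite !ord1 -dot_mulmx dotZr dotC dotZr -sqr_norm2 mxE.
    by rewrite eqxx mulr1n; field.
have [c ->] := AE x; pose y := usubmx (x : 'cV[R]_(1 + q)).
exists (col_mx (U^T *m v *m y + c) (norm2 u *: y)).
by rewrite mul_row_col mulmxDr {1}vE mulmxDl {1}uE -scalemxAl scalemxAr !mulmxA [RHS]addrC addrA.
Qed.

Lemma norm2_isometry d r (U : 'M[R]_(d, r)) c :
  U^T *m U = 1%:M -> norm2 (U *m c) = norm2 c.
Proof.
by move=> UU; rewrite /norm2 !dot_mulmx trmx_mul mulmxA -(mulmxA c^T) UU mulmx1.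
Qed.

(** Rounding down to a grid of mesh delta / D costs at most delta / D per coordinate, hence at most
    delta in the l^1 norm, which dominates [norm2]. *)
Lemma grid_net r (D : nat) (rho delta : R) :
  (0 < D)%N -> (r <= D)%N -> 0 < delta -> 0 <= rho ->
  exists s : seq 'cV[R]_r,
    (size s)%:R <= (2 * rho * D%:R / delta + 1) ^+ r /\
    forall c, norm2 c <= rho -> exists2 c', c' \in s & norm2 (c - c') <= delta.
Proof.
move=> D0 rD d0 rho0; pose eta := delta / D%:R.
have eta0 : 0 < eta by rewrite divr_gt0 // ltr0n.
pose N := Num.truncn (2 * rho / eta).
have ge0 : 0 <= 2 * rho / eta by rewrite divr_ge0 ?mulr_ge0 // ltW.
pose pt (f : {ffun 'I_r -> 'I_N.+1}) : 'cV[R]_r := \col_i ((f i)%:R * eta - rho).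
exists [seq pt f | f <- enum {ffun 'I_r -> 'I_N.+1}]; split.
  rewrite size_map -cardE card_ffun !card_ord natrX lerXn2r ?nnegrE //.
    by rewrite addr_ge0 // divr_ge0 ?mulr_ge0 // ltW.
  rewrite -natr1 lerD2r -[2 * rho * _ / _]mulrA -(invf_div delta).
  by have /andP[] := truncn_itv ge0.
move=> c crho; have cb i : 0 <= c i 0 + rho <= 2 * rho.
  by have := le_trans (coord_le_norm2 c i) crho; rewrite ler_norml; lra.
have fP i : (Num.truncn ((c i 0%R + rho) / eta) < N.+1)%N.
  rewrite ltnS le_truncn // ler_wpM2r ?invr_ge0 ?(ltW eta0) //.
  by case/andP: (cb i).
pose f := [ffun i => Ordinal (fP i)].
exists (pt f); first by apply: map_f; rewrite mem_enum.
apply: le_trans (norm2_le_sum _) _.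
apply: (@le_trans _ _ (\sum_(i < r) eta)); last first.
  rewrite sumr_const card_ord -mulr_natr /eta mulrAC -mulrA ler_piMr ?(ltW d0) //.
  by rewrite ler_pdivrMr ?ltr0n // mul1r ler_nat.
apply: ler_sum => i _; rewrite !mxE ffunE /=.
have /andP[h1 h2] := cb i.
have q0 : 0 <= (c i 0 + rho) / eta by rewrite divr_ge0 // ltW.
have := truncn_itv q0; set t := Num.truncn _ => /andP[].
rewrite ler_pdivlMr // ltr_pdivrMr // -natr1 => h3 h4.
by rewrite ler_norml; apply/andP; split; lra.
Qed.

(** A grid in the orthonormal coordinates of the range; the exponent is the number of columns,
    whatever the ambient dimension. *)
Lemma range_net d q (A : 'M[R]_(d, q)) (rho delta : R) :
  (0 < d)%N -> 0 < delta -> 0 <= rho ->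
  exists s : seq 'cV[R]_d,
    (size s)%:R <= (2 * rho * d%:R / delta + 1) ^+ q /\
    forall x, norm2 (A *m x) <= rho ->
      exists2 v, v \in s & norm2 (A *m x - v) <= delta.
Proof.
move=> d0 de0 rho0; have [r [U [rq UU AU]]] := gram_schmidt A.
have [s [sz sP]] := grid_net d0 (mulmx1_min UU) de0 rho0.
exists [seq U *m c | c <- s]; split.
  rewrite size_map (le_trans sz) // ler_weXn2l // lerDr.
  by rewrite divr_ge0 ?mulr_ge0 // ltW.
move=> x; have [c ->] := AU x; rewrite norm2_isometry // => /sP[c' c's cc'].
by exists (U *m c'); rewrite ?map_f // -mulmxBr norm2_isometry.
Qed.

Definition seminorm d (F : 'cV[R]_d -> R) :=
  (forall u v, F (u + v) <= F u + F v) /\ (forall c u, F (c *: u) = `|c| * F u).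

Lemma seminorm0 d (F : 'cV[R]_d -> R) : seminorm F -> F 0 = 0.
Proof. by case=> _ FZ; rewrite -(scale0r 0) FZ normr0 mul0r. Qed.

Lemma seminorm_ge0 d (F : 'cV[R]_d -> R) v : seminorm F -> 0 <= F v.
Proof.
move=> sF; have [FD FZ] := sF; have := FD v (- v).
by rewrite subrr (seminorm0 sF) -scaleN1r FZ normrN1 mul1r; lra.
Qed.

Lemma seminorm_sum d (F : 'cV[R]_d -> R) r (u : 'I_r -> 'cV[R]_d) :
  seminorm F -> F (\sum_i u i) <= \sum_i F (u i).
Proof.
move=> sF; elim/big_rec2 : _ => [|i x y _ h]; first by rewrite (seminorm0 sF).
by apply: le_trans (sF.1 _ _) _; rewrite lerD2l.
Qed.

(* Halving: a bound [B] for [F] on the unit ball improves to [M + B / 2]. *)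
Lemma seminorm_net d q (A : 'M[R]_(d, q)) : (0 < d)%N ->
  exists s : seq 'cV[R]_d,
  [/\ (size s)%:R <= (4 * d%:R + 1) ^+ q :> R,
      forall v, v \in s -> norm2 v <= 2 &
      forall F M, seminorm F -> (forall v, v \in s -> F v <= M) ->
        forall x, F (A *m x) <= 2 * M * norm2 (A *m x)].
Proof.
move=> d0; have [r [U [rq UU AU]]] := gram_schmidt A.
have h0 : 0 < 2^-1 :> R by rewrite invr_gt0.
have [s [sz sP]] := grid_net d0 (mulmx1_min UU) h0 (@ler01 R).
(* Grid points within 1/2 of a unit vector have norm at most 3/2, so they survive the filter. *)
exists [seq U *m c | c <- s & norm2 c <= 2]; split.
- rewrite size_map size_filter; apply: le_trans (_ : (size s)%:R <= _).
    by rewrite ler_nat count_size.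
  rewrite (le_trans sz) //.
  have -> : 2 * 1 * d%:R / 2^-1 + 1 = 4 * d%:R + 1 :> R by rewrite invrK; ring.
  by rewrite ler_weXn2l // lerDr.
- move=> v /mapP[c]; rewrite mem_filter => /andP[c2 _ ->].
  by rewrite norm2_isometry.
move=> F M sF FM x; have [c ->] := AU x; rewrite norm2_isometry // {x}.
(* A crude bound from the basis vectors, from which the halving starts. *)
pose B := \sum_i F (U *m delta_mx i 0).
have bnd0 y : F (U *m y) <= B * norm2 y.
  have -> : U *m y = \sum_i y i 0 *: (U *m delta_mx i 0).
    rewrite {1}(matrix_sum_delta y) mulmx_sumr; apply: eq_bigr => i _.
    by rewrite big_ord1 scalemxAr.
  apply: le_trans (seminorm_sum _ sF) _; rewrite mulr_suml.
  apply: ler_sum => i _; rewrite sF.2 mulrC ler_wpM2l ?coord_le_norm2 //.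
  exact: seminorm_ge0.
have bnd j y : F (U *m y) <= (2 * M + B / 2 ^+ j) * norm2 y.
  elim: j y => [|j IH] y.
    have M0 : 0 <= M.
      (* The grid point close to 0 survives the filter, so the bound [M] is attained somewhere and
         is nonnegative. *)
      have [c' c's cc'] : exists2 c', c' \in s & norm2 (0 - c') <= 2^-1.
        by apply: sP; rewrite norm20.
      apply: le_trans (seminorm_ge0 (U *m c') sF) (FM _ _).
      apply: map_f; rewrite mem_filter c's andbT.
      by move: cc'; rewrite sub0r norm2N; lra.
    apply: le_trans (bnd0 y) _; rewrite expr0 divr1 ler_wpM2r ?norm2_ge0 //.
    by rewrite lerDr mulr_ge0.
  have [/norm2_eq0 ->|y0] := eqVneq (norm2 y) 0.
    by rewrite mulmx0 (seminorm0 sF) norm20 mulr0.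
  have yp : 0 < norm2 y by rewrite lt0r y0 norm2_ge0.
  pose y1 := (norm2 y)^-1 *: y.
  have yE : y = norm2 y *: y1 by rewrite scalerA divff // scale1r.
  have n1 : norm2 y1 = 1 by rewrite norm2Z ger0_norm ?invr_ge0 ?norm2_ge0 // mulVf.
  have [|z zs yz] := sP y1; first by rewrite n1.
  have z2 : norm2 z <= 2.
    have := norm2D (z - y1) y1; rewrite subrK n1 -[z - y1]opprB norm2N; lra.
  have Fz : F (U *m z) <= M by apply: FM; rewrite map_f // mem_filter z2.
  rewrite {1}yE -scalemxAr sF.2 ger0_norm ?norm2_ge0 // mulrC.
  rewrite ler_wpM2r ?norm2_ge0 //.
  have -> : U *m y1 = U *m z + U *m (y1 - z) by rewrite -mulmxDr subrKC.
  apply: le_trans (sF.1 _ _) _; have h := IH (y1 - z).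
  have h' : (2 * M + B / 2 ^+ j) * norm2 (y1 - z) <= (2 * M + B / 2 ^+ j) * 2^-1.
    apply: ler_wpM2l => //; rewrite addr_ge0 ?mulr_ge0 //.
    + by apply: le_trans Fz; exact: seminorm_ge0.
    + by apply: sumr_ge0 => i _; exact: seminorm_ge0.
  rewrite exprSr invfM; lra.
(* An excess over 2 M |c| would exceed B |c| / 2^j for large j, against [bnd]. *)
rewrite leNgt; apply/negP => lt.
have B0 : 0 <= B by apply: sumr_ge0 => i _; exact: seminorm_ge0.
have gap : 0 < F (U *m c) - 2 * M * norm2 c by rewrite subr_gt0.
pose j := Num.truncn (B * norm2 c / (F (U *m c) - 2 * M * norm2 c)).
have j1 : B * norm2 c / (F (U *m c) - 2 * M * norm2 c) < j.+1%:R.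
  by apply: truncnS_gt.
have := bnd j.+1 c; apply/negP; rewrite -ltNge mulrDl -ltrBrDl.
rewrite mulrAC ltr_pdivrMr ?exprn_gt0 //.
move: j1; rewrite ltr_pdivrMr // => j1; apply: lt_le_trans j1 _.
rewrite [leRHS]mulrC ler_wpM2r ?(ltW gap) // -natrX ler_nat.
by apply: ltnW; exact: ltn_expl.
Qed.

End euclidean_geometry.

Lemma leq_expn_base (a b e : nat) : (a <= b)%N -> (a ^ e <= b ^ e)%N.
Proof. by case: e => // e; rewrite leq_exp2r. Qed.

(** * Linear pieces of a ReLU network *)

Section pieces.
Context {R : realType}.

(** Strict positivity marks the coordinates that the ReLU keeps; zeros are grouped with the negative
    values. *)
Definition sign_pattern k (x : 'cV[R]_k) (ws : seq 'rV[R]_k) : seq bool :=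
  [seq 0 < (w *m x) 0 0 | w <- ws].

(** Patterns on a hyperplane become patterns in one dimension less. *)
Lemma hyperplane_param k (w : 'rV[R]_k.+1) : w != 0 ->
  exists B : 'M[R]_(k.+1, k), forall x : 'cV_k.+1, w *m x = 0 -> exists z, x = B *m z.
Proof.
move=> w0; have rk : \rank (kermx w^T) = k.
  by rewrite mxrank_ker mxrank_tr rank_rV w0 subn1.
(* The dimension is kept as a rank here, so that [rk] can be rewritten in the type of [B]
   afterwards. *)
have : exists B : 'M[R]_(k.+1, \rank (kermx w^T)),
    forall x : 'cV_k.+1, w *m x = 0 -> exists z, x = B *m z.
  exists (row_base (kermx w^T))^T => x wx.
  have : (x^T <= row_base (kermx w^T))%MS.
    rewrite eq_row_base; apply/sub_kermxP.
    by rewrite -trmx_mul wx trmx0.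
  move=> /submxP[D xD]; exists D^T.
  by rewrite -trmx_mul -xD trmxK.
by rewrite rk.
Qed.

(* Deletion-restriction: the patterns of [ws] that occur on both sides of the
   hyperplane of [w] also occur on it, since pattern regions are convex. *)
Lemma sign_patterns k (ws : seq 'rV[R]_k) :
  exists s : seq (seq bool), (size s <= (size ws).+1 ^ k)%N /\
    forall x, sign_pattern x ws \in s.
Proof.
have [p] := ubnP (size ws); elim: p k ws => // p IH k [|w ws] szp.
  by exists [:: [::]]; rewrite exp1n.
case: k w ws szp => [|k] w ws szp.
  exists [:: sign_pattern 0 (w :: ws)]; split=> // x.
  by rewrite (flatmx0 x) mem_head.
have [s1 [sz1 s1P]] := IH _ ws szp.
have [w0|w0] := eqVneq w 0.
  exists [seq false :: q | q <- s1]; split.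
    by rewrite size_map (leq_trans sz1) // leq_exp2r.
  by move=> x; rewrite /= w0 mul0mx mxE ltxx map_f //; exact: s1P.
have [B BP] := hyperplane_param w0.
have [|s2 [sz2 s2P]] := IH _ [seq v *m B | v <- ws]; first by rewrite size_map.
have {}s2P z : sign_pattern (B *m z) ws \in s2.
  have := s2P z; rewrite /sign_pattern -map_comp.
  by under eq_map do rewrite /= -mulmxA.
rewrite size_map in sz2.
(* A pattern outside [s2] occurs on one side of the hyperplane only, and [side] tells which.
   Patterns in [s2] get [false] here and [true] from the first list. *)
pose side q := (q \notin s2) &&
  `[< exists x, sign_pattern x ws = q /\ 0 < (w *m x) 0 0 >].
exists ([seq true :: q | q <- s2] ++ [seq side q :: q | q <- s1]); split.
  rewrite size_cat !size_map (leq_trans (leq_add sz2 sz1)) //=.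
  (* With p the size of [ws]: (p+1)^k + (p+1)^(k+1) = (p+2) (p+1)^k <= (p+2)^(k+1). *)
  rewrite [X in (_ <= X)%N]expnS [in X in (_ + X <= _)%N]expnS.
  by rewrite -mulSn leq_mul2l leq_expn_base ?orbT.
move=> x; rewrite mem_cat /=; case: ltP => wx; last first.
  suff -> : false = side (sign_pattern x ws).
    by apply/orP; right; apply: (map_f (fun q => side q :: q)); exact: s1P.
  apply/esym/negbTE/negP => /andP[nq /asboolP[x' [xx' wx']]].
  (* A nonnegative combination of [x] and [x'], positive on [x], chosen to lie on the hyperplane; it
     inherits their common pattern. *)
  pose y := (w *m x') 0 0 *: x + (- (w *m x) 0 0) *: x'.
  have wy : w *m y = 0.
    apply/matrixP => i j; rewrite !ord1 mulmxDr -!scalemxAr !mxE; ring.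
  have [z yz] := BP y wy.
  suff yx : sign_pattern y ws = sign_pattern x ws.
    by move: nq; rewrite -yx yz s2P.
  have /eq_in_map xx := xx'; apply/eq_in_map => v vws; have := xx v vws.
  have -> : (v *m y) 0 0 = (w *m x') 0 0 * (v *m x) 0 0 - (w *m x) 0 0 * (v *m x') 0 0.
    by rewrite mulmxDr -!scalemxAr [LHS]mxE [X in X + _]mxE [X in _ + X]mxE mulNr.
  move: wx wx'; set a := (w *m x') 0 0; set b := (w *m x) 0 0.
  set e := (v *m x') 0 0; set f := (v *m x) 0 0 => wx wx'.
  case: (ltP 0 f) => f0; case: (ltP 0 e) => // e0 _; apply/idP.
    have := mulr_gt0 wx' f0; have : - b * e >= 0 by rewrite mulr_ge0 ?oppr_ge0 // ltW.
    lra.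
  apply/negP; rewrite -leNgt; have := mulr_ge0_le0 (ltW wx') f0.
  have : - b * e <= 0 by rewrite mulr_ge0_le0 ?oppr_ge0.
  lra.
have [q2|q2] := boolP (sign_pattern x ws \in s2).
  by apply/orP; left; exact: map_f.
suff -> : true = side (sign_pattern x ws).
  by apply/orP; right; apply: (map_f (fun q => side q :: q)); exact: s1P.
by rewrite /side q2; apply/esym/asboolP; exists x.
Qed.

(** Once the sign pattern is fixed, the ReLU only zeroes the rows of [M] that the pattern marks
    [false]. *)
Lemma relu_pieces p k (M : 'M[R]_(p, k)) :
  exists s : seq 'M[R]_(p, k), (size s <= p.+1 ^ k)%N /\
    forall x, exists2 A, A \in s & relu (M *m x) = A *m x.
Proof.
have [s [sz sP]] := sign_patterns [seq row i M | i <- enum 'I_p].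
rewrite size_map size_enum_ord in sz.
pose piece (q : seq bool) := \matrix_(i, j) (M i j *+ nth false q i).
exists [seq piece q | q <- s]; split; first by rewrite size_map.
move=> x; exists (piece (sign_pattern x [seq row i M | i <- enum 'I_p])).
  by apply: map_f; exact: sP.
apply/colP => i; rewrite 3!mxE.
have nthE : nth false (sign_pattern x [seq row i0 M | i0 <- enum 'I_p]) i =
    (0 < \sum_j M i j * x j 0).
  rewrite /sign_pattern -map_comp (nth_map i) ?size_enum_ord //= nth_ord_enum.
  by rewrite -row_mul !mxE.
under [RHS]eq_bigr do rewrite mxE nthE.
rewrite maxElt; case: ifP => _; first by under [RHS]eq_bigr do rewrite mulr1n.
by under [RHS]eq_bigr do rewrite mulr0n mul0r; rewrite big1.
Qed.

(** On a piece [A] of the first layers the next preactivation is linear in the [w 0] input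
    variables. Each layer therefore multiplies the count by (D+1)^(w 0), with the input dimension
    and not the width in the exponent. *)
Lemma relu_net_pieces (w : nat -> nat) (W : forall i, 'M[R]_(w i.+1, w i)) D n :
  (forall i, (1 <= i <= n)%N -> (w i <= D)%N) ->
  exists s : seq 'M[R]_(w n, w 0), (size s <= D.+1 ^ (w 0 * n))%N /\
    forall x, exists2 A, A \in s & relu_net W n x = A *m x.
Proof.
elim: n => [|n IH] wD.
  exists [:: 1%:M]; rewrite muln0; split=> // x.
  by exists 1%:M; rewrite ?mem_head // mul1mx.
have [i /andP[i1 ni]|s [sz sP]] := IH; first by apply: wD; rewrite i1 ltnW.
have cP (A : 'M[R]_(w n, w 0)) := cid (relu_pieces (W n *m A)).
exists (flatten [seq sval (cP A) | A <- s]); split.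
  rewrite size_flatten /shape -map_comp sumnE big_map.
  rewrite mulnS expnD mulnC; apply: leq_trans (_ : size s * D.+1 ^ w 0 <= _)%N.
    rewrite -sum1_size big_distrl /=; apply: leq_sum => A _; rewrite mul1n.
    have [h _] := svalP (cP A); rewrite (leq_trans h) //; by rewrite leq_expn_base // ltnS wD // leqnn.
  by rewrite leq_mul2r sz orbT.
move=> x; have [A As /= ->] := sP x; have [_ /(_ x)[A' A's]] := svalP (cP A).
rewrite -mulmxA => ->; exists A' => //; apply/flatten_mapP.
by exists A.
Qed.

End pieces.

(** * Independence *)

Section independence.
Local Open Scope ereal_scope.
Context d (T : measurableType d) (R : realType) (P : probability T R).

Lemma sigma_of_preimage d' (T' : measurableType d') (X : T -> T') B :
  measurable B -> sigma_of X (X @^-1` B).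
Proof. by move=> mB; exists B => //; rewrite setTI. Qed.

Lemma measurable_preimageT d' (T' : measurableType d') (X : T -> T') B :
  measurable_fun setT X -> measurable B -> measurable (X @^-1` B).
Proof. by move=> mX mB; rewrite -[X in measurable X]setTI; exact: mX. Qed.

Import HBNNSimple.

(** The weights are written [|k|] so that every term is visibly nonnegative, whatever the list
    contains. *)
Lemma nnsfun_sum d' (T' : measurableType d') (h : {nnsfun T' >-> R}) :
  exists s : seq R,
    forall y, (h y = \sum_(k <- s) `|k| * \1_(h @^-1` [set k]) y)%R.
Proof.
eexists => y; rewrite {1}(fimfunE h) fsbig_finite //= big_seq [RHS]big_seq.
apply: eq_bigr => k; rewrite in_fset_set // inE => -[z _ <-].
by rewrite ger0_norm.
Qed.

(** The bound for indicators passes to simple functions by linearity and to [f] by monotone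
    convergence. *)
Lemma le_integral_comp_mul d' (T' : measurableType d') (Z : T -> T')
    (G : T -> R) (kappa : R) (f : T' -> \bar R) :
  measurable_fun setT Z -> measurable_fun setT G -> (forall x, 0 <= G x)%R ->
  (0 <= kappa)%R -> measurable_fun setT f -> (forall y, 0 <= f y) ->
  (forall B, measurable B ->
     \int[P]_x (\1_B (Z x) * G x)%:E <= kappa%:E * P (Z @^-1` B)) ->
  \int[P]_x (f (Z x) * (G x)%:E) <= kappa%:E * \int[P]_x f (Z x).
Proof.
move=> mZ mG G0 k0 mf f0 HB.
have mfZ : measurable_fun setT (fun x => f (Z x)) by exact: measurableT_comp.
pose g := nnsfun_approx measurableT mf.
have gf y : (g n y)%:E @[n --> \oo] --> f y.
  exact: (@cvg_nnsfun_approx _ _ _ _ measurableT _ mf (fun x _ => f0 x)).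
have nd y : {homo (fun n => (g n y)%:E) : n m / (n <= m)%N >-> n <= m}.
  by move=> n m nm; rewrite lee_fin; have /(_ _ _ nm)/lefP := nd_nnsfun_approx measurableT mf; exact.
have mgZ n : measurable_fun setT (fun x => g n (Z x)) by exact: measurableT_comp.
have gle n y : (g n y)%:E <= f y.
  rewrite -(cvg_lim _ (gf y)) // (cvg_lim _ (ereal_nondecreasing_cvgn (nd y))) //.
  by apply: ereal_sup_ubound; exists n.
have -> : \int[P]_x (f (Z x) * (G x)%:E) =
    \int[P]_x (limn (fun n => ((g n (Z x))%:E * (G x)%:E))).
  apply: eq_integral => x _; apply/esym/cvg_lim => //.
  by apply: cvgeZr => //; exact: gf.
rewrite monotone_convergence //; last 3 first.
- by move=> n; apply/measurable_EFinP; exact: measurable_funM.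
- by move=> n x _; rewrite lee_fin mulr_ge0.
- by move=> x _ n m nm; apply: lee_wpmul2r; [rewrite lee_fin|exact: nd].
apply: lime_le.
  apply: ereal_nondecreasing_is_cvgn => n m nm; apply: ge0_le_integral => //.
  - by move=> x _; rewrite lee_fin mulr_ge0.
  - by apply/measurable_EFinP; exact: measurable_funM.
  - by apply/measurable_EFinP; exact: measurable_funM.
  - by move=> x _; apply: lee_wpmul2r; [rewrite lee_fin|exact: nd].
apply: nearW => n; apply: (@le_trans _ _ (kappa%:E * \int[P]_x (g n (Z x))%:E)); last first.
  rewrite lee_wpmul2l ?lee_fin //; apply: ge0_le_integral => //.
  - by move=> x _; rewrite lee_fin.
  - exact/measurable_EFinP.
have [s hE] := nnsfun_sum (g n); move: hE; set h := g n => hE.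
have mI k : measurable_fun setT (fun x => \1_(h @^-1` [set k]) (Z x) : R).
  by apply: measurableT_comp => //; exact: measurable_indic.
have mp k : measurable (h @^-1` [set k]).
  by rewrite -[X in measurable X]setTI; exact: measurable_funP.
have sumE (F : T -> R) : measurable_fun setT F -> (forall x, 0 <= F x)%R ->
    \int[P]_x (h (Z x) * F x)%:E =
    \sum_(k <- s) `|k|%:E * \int[P]_x (\1_(h @^-1` [set k]) (Z x) * F x)%:E.
  move=> mF F0.
  have mIF k : measurable_fun setT (fun x => (\1_(h @^-1` [set k]) (Z x) * F x)%:E).
    by apply/measurable_EFinP; exact: measurable_funM.
  transitivity (\int[P]_x (\sum_(k <- s)
      (`|k|%:E * (\1_(h @^-1` [set k]) (Z x) * F x)%:E))).
    apply: eq_integral => x _; rewrite hE mulr_suml -sumEFin.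
    by apply: eq_bigr => k _; rewrite -EFinM mulrA.
  rewrite ge0_integral_sum //; last 2 first.
  - by move=> k; exact: measurable_funeM.
  - by move=> k x _; rewrite mule_ge0 // lee_fin ?mulr_ge0.
  apply: eq_bigr => k _; rewrite ge0_integralZl_EFin // => x _.
  by rewrite lee_fin mulr_ge0.
rewrite (sumE G) //.
have -> : \int[P]_x (h (Z x))%:E = \int[P]_x (h (Z x) * cst 1 x)%:E.
  by apply: eq_integral => x _; rewrite mulr1.
rewrite (sumE (cst 1)%R) // ge0_sume_distrr; last first.
  move=> k _; rewrite mule_ge0 ?lee_fin //; apply: integral_ge0 => x _.
  by rewrite lee_fin mulr_ge0.
apply: lee_sum => k _; rewrite muleCA lee_wpmul2l ?lee_fin //.
apply: le_trans (HB _ (mp k)) _; rewrite lee_wpmul2l ?lee_fin //.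
have mZk : measurable (Z @^-1` (h @^-1` [set k])) by exact: measurable_preimageT.
rewrite -[X in P X]setIT -integral_indic //.
by rewrite le_eqVlt; apply/orP; left; apply/eqP/eq_integral => x _; rewrite mulr1.
Qed.

Context (I : finType) d' (T' : measurableType d') (Z : I -> T -> T').
Hypothesis mZ : forall i, measurable_fun setT (Z i).
Hypothesis indepZ : mutually_independent P (fun i => sigma_of (Z i)).

Let meet (K : {set I}) (B : I -> set T') : set T :=
  \bigcap_(i in [set` K]) (Z i @^-1` B i).

Let measurable_meet K B : (forall i, measurable (B i)) -> measurable (meet K B).
Proof.
move=> mB; apply: fin_bigcap_measurable; first exact: finite_finset.
by move=> i _; exact: measurable_preimageT.
Qed.

Let PmeetU1 (K : {set I}) (B : I -> set T') i : (forall i, measurable (B i)) -> i \notin K ->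
  P (meet (i |: K) B) = P (meet K B) * P (Z i @^-1` B i).
Proof.
move=> mB iK.
have mK := measurable_meet K mB; have mU := measurable_meet (i |: K) mB.
have mi : measurable (Z i @^-1` B i) by exact: measurable_preimageT.
rewrite -[LHS]fineK ?fin_num_measure // -[X in X * _]fineK ?fin_num_measure //.
rewrite -[X in _ * X]fineK ?fin_num_measure // -EFinM; congr EFin.
rewrite !indepZ; [|by move=> *; exact: sigma_of_preimage..].
by rewrite big_setU1 //= mulrC.
Qed.

(* Independence is used one factor at a time, the remaining factors being
   indicators of the events [Z i \in B i]. *)
Let le_integral_meet_prod (f : T' -> R) (c : R) (s : seq I) (K : {set I})
    (B : I -> set T') :
  measurable_fun setT f -> (forall y, 0 <= f y)%R -> (0 <= c)%R ->
  (forall i, \int[P]_x (f (Z i x))%:E <= c%:E) ->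
  (forall i, measurable (B i)) -> uniq s -> {in s, forall i, i \notin K} ->
  \int[P]_x (\1_(meet K B) x * \prod_(i <- s) f (Z i x))%:E <=
    (c ^+ size s)%:E * P (meet K B).
Proof.
move=> mf f0 c0 fc; elim: s K B => [|i s IH] K B mB /=.
  move=> _ _; rewrite expr0 mul1e -[X in P X]setIT -integral_indic //; last exact: measurable_meet.
  by rewrite le_eqVlt; apply/orP; left; apply/eqP/eq_integral => x _; rewrite big_nil mulr1.
move=> /andP[i_s us] sK.
pose G x := (\1_(meet K B) x * \prod_(j <- s) f (Z j x))%R.
have mG : measurable_fun setT G.
  apply: measurable_funM; first exact/measurable_indic/measurable_meet.
  by apply: measurable_prod => j _; exact: measurableT_comp.
have G0 x : (0 <= G x)%R by rewrite mulr_ge0 // prodr_ge0.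
have iK : i \notin K by apply: sK; rewrite mem_head.
have mK := measurable_meet K mB.
have PfK : (0 <= c ^+ size s * fine (P (meet K B)))%R.
  by rewrite mulr_ge0 ?exprn_ge0 // fine_ge0.
(* The factor at [i] is split off; the others, with the indicator, form the weight [G]. *)
have := @le_integral_comp_mul _ _ (Z i) G _ (EFin \o f) (mZ i) mG G0 PfK.
have -> : \int[P]_x ((EFin \o f) (Z i x) * (G x)%:E) =
    \int[P]_x (\1_(meet K B) x * \prod_(j <- i :: s) f (Z j x))%:E.
  apply: eq_integral => x _; rewrite -EFinM /G big_cons; congr EFin => /=; ring.
move=> H; apply: le_trans (H _ _ _) _.
- exact/measurable_EFinP.
- by move=> y; rewrite lee_fin.
(* The indicator of [Z i] in [C] is absorbed by adding [i] to [K], so the induction hypothesis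
   applies to the remaining factors. *)
- move=> C mC; pose B' j := if j == i then C else B j.
  have mB' j : measurable (B' j) by rewrite /B'; case: ifP.
  have KE : meet K B' = meet K B.
    apply: eq_bigcapr => j /= jK; rewrite /B' ifN //.
    by apply: contraNneq iK => <-.
  have iKE : meet (i |: K) B' = (Z i @^-1` C) `&` meet K B.
    rewrite -KE; apply/seteqP; split=> x.
      move=> h; split; last by move=> j /= jK; apply: h; rewrite /= !inE jK orbT.
      by have := h i; rewrite /= !inE eqxx /B' eqxx; apply.
    move=> [h1 h2] j /=; rewrite !inE => /orP[/eqP ->|jK]; last exact: h2.
    by rewrite /B' /= eqxx.
  have -> : \int[P]_x (\1_C (Z i x) * G x)%:E =
     \int[P]_x (\1_(meet (i |: K) B') x * \prod_(j <- s) f (Z j x))%:E.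
    apply: eq_integral => x _; rewrite /G mulrA iKE; congr (_ * _)%:E.
    by rewrite indicI /= !indicE.
  apply: le_trans (IH _ _ mB' us _) _.
    move=> j js; rewrite !inE negb_or sK ?inE ?js ?orbT // andbT.
    by apply: contraNneq i_s => <-.
  rewrite PmeetU1 // KE /B' eqxx EFinM fineK ?fin_num_measure //.
  by rewrite muleA.
set p := fine _; rewrite -[P _]fineK ?fin_num_measure // -/p -EFinM exprSr.
rewrite -mulrA [(c * p)%R]mulrC mulrA [X in _ <= X]EFinM.
by apply: lee_wpmul2l; [rewrite lee_fin|exact: fc].
Qed.

Lemma le_integral_indep_prod (f : T' -> R) (c : R) :
  measurable_fun setT f -> (forall y, 0 <= f y)%R -> (0 <= c)%R ->
  (forall i, \int[P]_x (f (Z i x))%:E <= c%:E) ->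
  \int[P]_x (\prod_i f (Z i x))%:E <= (c ^+ #|I|)%:E.
Proof.
move=> mf f0 c0 fc.
have := @le_integral_meet_prod f c (index_enum I) (@finset.set0 I) (fun=> setT) mf f0 c0 fc.
have -> : meet (@finset.set0 I) (fun=> setT) = setT.
  by apply/seteqP; split=> // x _ j; rewrite /= inE.
rewrite probability_setT mule1 [size _](_ : _ = #|I|); last first.
  by rewrite cardT enumT.
under eq_integral do rewrite indicT mul1r.
by apply => //; [exact: index_enum_uniq|move=> i _; rewrite inE].
Qed.

(** Markov's inequality for the exponential of the sum, whose mean is bounded by the product of the
    individual bounds. *)
Lemma chernoff_indep (phi : T' -> R) (c t : R) :
  measurable_fun setT phi ->
  (forall i, \int[P]_x (expR (phi (Z i x)))%:E <= (expR c)%:E) ->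
  P [set x | (t <= \sum_i phi (Z i x))%R] <= (expR (#|I|%:R * c - t))%:E.
Proof.
move=> mphi phic.
have mS : measurable_fun setT (fun x => (\sum_i phi (Z i x))%R).
  by apply: measurable_sum => i; exact: measurableT_comp.
have mA : measurable [set x | (t <= \sum_i phi (Z i x))%R].
  rewrite -[X in measurable X]setTI.
  by apply: measurable_fun_ler => //; exact: measurable_cst.
rewrite -[X in P X]setIT -integral_indic //.
apply: (@le_trans _ _ (\int[P]_x ((expR (- t))%:E * (\prod_i expR (phi (Z i x)))%:E))).
  have mprod : measurable_fun setT (fun x => (\prod_i expR (phi (Z i x)))%R).
    apply: measurable_prod => i _; apply: measurableT_comp => //.
    exact: measurableT_comp.
  apply: ge0_le_integral => //.
  - exact/measurable_EFinP/measurable_indic.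
  - by apply: measurable_funeM; exact/measurable_EFinP.
  move=> x _; rewrite -EFinM lee_fin -expR_sum -expRD indicE.
  case: (boolP (x \in _)) => [|_]; last exact: expR_ge0.
  by rewrite inE /= => tx; rewrite -[leLHS]expR0 ler_expR; lra.
rewrite ge0_integralZl_EFin ?expR_ge0 //; last 2 first.
- by move=> x _; rewrite lee_fin prodr_ge0 // => i _; exact: expR_ge0.
- apply/measurable_EFinP; apply: measurable_prod => i _.
  by apply: measurableT_comp => //; exact: measurableT_comp.
have mexp : measurable_fun setT (fun y => expR (phi y)) by exact: measurableT_comp.
have := le_integral_indep_prod mexp (fun=> expR_ge0 _) (expR_ge0 c) phic.
rewrite addrC expRD EFinM expRM_natl => H.
by rewrite lee_wpmul2l ?lee_fin ?expR_ge0.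
Qed.

End independence.

(** * Laws of independent pairs and triples *)

Section product_laws.
Local Open Scope ereal_scope.
Context d (T : measurableType d) (R : realType) (P : probability T R).
Context d1 (T1 : measurableType d1) d2 (T2 : measurableType d2).

Definition pair_mfun (X : {mfun T >-> T1}) (Y : {mfun T >-> T2}) :
    {mfun T >-> (T1 * T2)%type} :=
  HB.pack (fun w => (X w, Y w)) (isMeasurableFun.Build _ _ _ _ _
    (measurable_fun_pair (measurable_funP X) (measurable_funP Y))).

Lemma distribution_indep_pair (X : {mfun T >-> T1}) (Y : {mfun T >-> T2}) :
  (forall A B, measurable A -> measurable B ->
     P (X @^-1` A `&` Y @^-1` B) = P (X @^-1` A) * P (Y @^-1` B)) ->
  forall S, measurable S ->
    (distribution P X \x distribution P Y) S = distribution P (pair_mfun X Y) S.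
Proof.
move=> XY; apply: product_measure_unique => A B mA mB.
by rewrite /distribution /pushforward -XY.
Qed.

(** Tonelli for the product law: [Y] is integrated out with [X] frozen. *)
Lemma integral_indep_pair (X : {mfun T >-> T1}) (Y : {mfun T >-> T2})
    (f : T1 * T2 -> \bar R) :
  (forall A B, measurable A -> measurable B ->
     P (X @^-1` A `&` Y @^-1` B) = P (X @^-1` A) * P (Y @^-1` B)) ->
  measurable_fun setT f -> (forall z, 0 <= f z) ->
  \int[P]_w f (X w, Y w) = \int[P]_w \int[distribution P Y]_y f (X w, y).
Proof.
move=> XY mf f0.
have -> : \int[P]_w f (X w, Y w) = \int[distribution P (pair_mfun X Y)]_z f z.
  by rewrite ge0_integral_distribution.
rewrite (eq_measure_integral (distribution P X \x distribution P Y)); last first.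
  by move=> A mA _; apply/esym; exact: distribution_indep_pair.
rewrite fubini_tonelli1 // -(@ge0_integral_distribution _ _ _ _ _ P X
  (fun x => \int[distribution P Y]_y f (x, y))) //.
- exact: measurable_fun_fubini_tonelli_F.
- by move=> x; apply: integral_ge0.
Qed.

Lemma integral_indep_pair_mul (X : {mfun T >-> T1}) (Y : {mfun T >-> T2})
    (f : T1 -> R) (g : T2 -> R) :
  (forall A B, measurable A -> measurable B ->
     P (X @^-1` A `&` Y @^-1` B) = P (X @^-1` A) * P (Y @^-1` B)) ->
  measurable_fun setT f -> measurable_fun setT g ->
  P.-integrable setT (fun w => (f (X w) * g (Y w))%:E) ->
  P.-integrable setT (fun w => (g (Y w))%:E) ->
  \int[P]_w (g (Y w))%:E = 0 ->
  \int[P]_w (f (X w) * g (Y w))%:E = 0.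
Proof.
move=> /distribution_indep_pair E mf mg ifg ig g0.
pose F (z : T1 * T2) := (f z.1 * g z.2)%:E.
have mF : measurable_fun setT F.
  by apply/measurable_EFinP; apply: measurable_funM; exact: measurableT_comp.
have -> : \int[P]_w (f (X w) * g (Y w))%:E = \int[distribution P (pair_mfun X Y)]_z F z.
  by rewrite integral_distribution.
have iF : (distribution P X \x distribution P Y).-integrable setT F.
  apply/integrableP; split => //.
  rewrite (eq_measure_integral (distribution P (pair_mfun X Y))); last first.
    by move=> A mA _; exact: E.
  rewrite ge0_integral_distribution //; last exact: measurableT_comp.
  by case/integrableP : ifg.
rewrite (eq_measure_integral (distribution P X \x distribution P Y)); last first.
  by move=> A mA _; apply/esym; exact: E.
rewrite -integral12_prod_meas1 // integral0_eq // => x _; rewrite /fubini_F /F /=.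
under eq_integral do rewrite EFinM.
rewrite integralZl //.
  rewrite (@integral_distribution _ _ _ _ _ P Y (EFin \o g)) ?g0 ?mule0 //.
  exact/measurable_EFinP.
apply/integrableP; split; first exact/measurable_EFinP.
rewrite (@ge0_integral_distribution _ _ _ _ _ P Y (fun y => `|(g y)%:E|)) //.
  by case/integrableP : ig.
by apply: measurableT_comp => //; exact/measurable_EFinP.
Qed.

(** For fixed [C], both sides are measures in [S]. They agree on rectangles with the product of the
    law of [X] and the law of [Y] scaled by the probability of [Z] in [C], hence everywhere. *)
Lemma indep_pair_third d3 (T3 : measurableType d3) (X : {mfun T >-> T1})
    (Y : {mfun T >-> T2}) (Z : {mfun T >-> T3}) :
  (forall A B C, measurable A -> measurable B -> measurable C ->
     P (X @^-1` A `&` Y @^-1` B `&` Z @^-1` C) =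
     P (X @^-1` A) * P (Y @^-1` B) * P (Z @^-1` C)) ->
  forall S C, measurable S -> measurable C ->
    P (pair_mfun X Y @^-1` S `&` Z @^-1` C) =
    P (pair_mfun X Y @^-1` S) * P (Z @^-1` C).
Proof.
set XY := pair_mfun X Y => H S C mS mC.
have mZC : measurable (Z @^-1` C) by exact: measurable_preimageT.
have c0 : (0 <= fine (P (Z @^-1` C)))%R by rewrite fine_ge0.
pose c := NngNum c0.
have mXY : measurable_fun setT XY by [].
pose m1 := [the {measure set _ -> \bar R} of pushforward (mrestr P mZC) XY].
pose m2 := [the {measure set _ -> \bar R} of mscale c (distribution P XY)].
pose mY := [the {finite_measure set _ -> \bar R} of mscale c (distribution P Y)].
have XYr A B : XY @^-1` (A `*` B) = X @^-1` A `&` Y @^-1` B.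
  by apply/seteqP; split.
have cE : c%:num%:E = P (Z @^-1` C) by rewrite /= fineK ?fin_num_measure.
have E1 : (distribution P X \x mY) S = m1 mXY S.
  apply: product_measure_unique => // A B mA mB.
  rewrite /m1 /= /pushforward /mrestr XYr H // /mY /= /mscale cE /distribution /pushforward.
  by rewrite -!muleA (muleC (P (Z @^-1` C))).
have E2 : (distribution P X \x mY) S = m2 S.
  apply: product_measure_unique => // A B mA mB.
  transitivity (P (X @^-1` A) * (P (Z @^-1` C) * P (Y @^-1` B))); last by rewrite -cE.
  transitivity (P (Z @^-1` C) * P (XY @^-1` (A `*` B))); first by rewrite -cE.
  rewrite XYr -[_ `&` _]setIT -(preimage_setT Z) H // preimage_setT.
  by rewrite probability_setT mule1 muleCA.
have : m1 mXY S = m2 S by rewrite -E1 -E2.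
by rewrite /m1 /m2 /= /mscale cE muleC.
Qed.

End product_laws.

Lemma mutually_independent3 d (T : measurableType d) (R : realType)
    (P : probability T R) (F0 F1 F2 : set (set T)) A B C :
  mutually_independent P (tnth [tuple F0; F1; F2]) -> F0 A -> F1 B -> F2 C ->
  measurable A -> measurable B -> measurable C ->
  P (A `&` B `&` C) = (P A * P B * P C)%E.
Proof.
move=> H FA FB FC mA mB mC.
have := H [set: 'I_3]%SET (tnth [tuple A; B; C]).
have -> : \bigcap_(i in [set` [set: 'I_3]%SET]) tnth [tuple A; B; C] i = A `&` B `&` C.
  apply/seteqP; split=> x.
    move=> h; split; first split.
    - by apply: (h (@Ordinal 3 0 isT)); rewrite /= inE.
    - by apply: (h (@Ordinal 3 1 isT)); rewrite /= inE.
    - by apply: (h (@Ordinal 3 2 isT)); rewrite /= inE.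
  by move=> [[hA hB] hC] [[|[|[|//]]] p] _.
move=> E; rewrite -[LHS]fineK ?fin_num_measure //; last by apply: measurableI => //; exact: measurableI.
rewrite E; last by move=> [[|[|[|//]]] p] _.
under eq_bigl do rewrite inE.
rewrite !big_ord_recl big_ord0 mulr1 /= mulrA !EFinM.
by rewrite !fineK ?fin_num_measure.
Qed.

(** * Exponential moments *)

Section exponential_moments.
Context {R : realType}.

(** The inequality exp(-1/2) >= 1 - 1/2, squared. *)
Lemma expR1_le4 : expR 1 <= 4 :> R.
Proof.
have h : 2^-1 <= expR (- 2^-1) :> R by have := expR_ge1Dx (- 2^-1 : R); lra.
have h2 : expR 1 * (expR (- 2^-1) * expR (- 2^-1)) = 1 :> R.
  by rewrite -!expRD (_ : 1 + _ = 0) ?expR0 //; field.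
have p := expR_gt0 (1 : R).
have : 2^-1 * 2^-1 <= expR (- 2^-1) * expR (- 2^-1) :> R by rewrite ler_pM.
rewrite -(ler_pM2l p) h2; lra.
Qed.

Lemma sqr_le_expR (x : R) : 0 <= x -> x ^+ 2 <= 2 * expR x.
Proof.
by move=> x0; have := expR_ge1Dxn 1 x0; rewrite (_ : 2`!%:R = 2 :> R) //; lra.
Qed.

(** The inductive step uses (1 + 1/n)^n <= e <= 4. *)
Lemma powers_le_fact (n : nat) : (n%:R ^+ n <= 4 ^+ n * n`!%:R :> R).
Proof.
elim: n => [|n IH]; first by rewrite !expr0 mul1r.
have [->|n0] := posnP n; first by rewrite !expr1 mulr1; lra.
have n0' : 0 < n%:R :> R by rewrite ltr0n.
have step : n.+1%:R ^+ n <= 4 * n%:R ^+ n :> R.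
  have -> : n.+1%:R = n%:R * (1 + n%:R^-1) :> R.
    by rewrite -natr1 mulrDr mulr1 divff // gt_eqF.
  rewrite exprMn mulrC ler_wpM2r ?exprn_ge0 //.
  apply: le_trans expR1_le4; apply: le_trans (_ : expR n%:R^-1 ^+ n <= _).
    by rewrite lerXn2r ?nnegrE ?expR_ge0 ?expR_ge1Dx // addr_ge0 // invr_ge0 ltW.
  by rewrite -expRM_natl divff ?gt_eqF.
rewrite exprS factS natrM.
apply: le_trans (_ : n.+1%:R * (4 * (4 ^+ n * n`!%:R)) <= _); last by rewrite exprS; lra.
by rewrite ler_wpM2l // (le_trans step) // ler_wpM2l.
Qed.

Lemma sum_half_le2 n : \sum_(i < n) (2^-1) ^+ i <= 2 :> R.
Proof.
suff : \sum_(i < n) (2^-1) ^+ i = 2 - 2 * (2^-1) ^+ n :> R.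
  by move=> ->; rewrite gerBl mulr_ge0 ?exprn_ge0 // invr_ge0.
elim: n => [|n IH]; first by rewrite big_ord0 expr0; ring.
by rewrite big_ord_recr /= IH exprSr; field.
Qed.

End exponential_moments.

Section psi1.
Local Open Scope ereal_scope.
Context d (T : measurableType d) (R : realType) (P : probability T R).

Lemma psi1_moment (X : T -> R) (Q : R) n :
  measurable_fun setT X -> psi1_norm P X <= Q%:E -> (0 < n)%N -> (0 <= Q)%R ->
  \int[P]_w (`|X w| ^+ n)%:E <= ((n%:R * Q) ^+ n)%:E.
Proof.
move=> mX XQ n0 Q0.
have np : (0 < n%:R :> R)%R by rewrite ltr0n.
have : (n%:R^-1)%:E * 'N[P]_(n%:R%:E)[EFin \o X] <= Q%:E.
  apply: le_trans XQ; apply: ereal_sup_ubound; exists n%:R => //=.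
  by rewrite ler1n.
rewrite lee_pdivrMl // -EFinM unlock /=.
under eq_integral do rewrite powR_mulrn //.
set I := \int[P]_w _ => IQ.
have I0 : 0 <= I by apply: integral_ge0 => w _; rewrite lee_fin exprn_ge0.
have -> : I = (I `^ n%:R^-1) `^ n%:R.
  by rewrite -poweRrM mulVf ?gt_eqF // poweRe1.
rewrite -powR_mulrn ?mulr_ge0 // -poweR_EFin.
apply: gt0_ler_poweR => //.
- by rewrite in_itv /= poweR_ge0 leey.
- by rewrite in_itv /= lee_fin mulr_ge0 ?leey // ltW.
Qed.

(** The exponential series is integrated term by term: the n-th term is at most n^n Q^n / ((8 Q)^n
    n!) <= (4/8)^n, and the geometric series sums to at most 2. *)
Lemma psi1_expR (X : T -> R) (Q : R) :
  measurable_fun setT X -> psi1_norm P X <= Q%:E -> (0 < Q)%R ->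
  \int[P]_w (expR (`|X w| / (8 * Q)))%:E <= 2%:E.
Proof.
move=> mX XQ Q0.
pose Y w := (`|X w| / (8 * Q))%R.
have Y0 w : (0 <= Y w)%R by rewrite divr_ge0 // mulr_ge0 // ltW.
have mY : measurable_fun setT Y.
  by apply: measurable_funM => //; exact: measurableT_comp.
pose f n w := (exp_coeff (Y w) n)%:E.
have f0 n w : 0 <= f n w by rewrite lee_fin /exp_coeff divr_ge0 // exprn_ge0.
have mf n : measurable_fun setT (f n).
  apply/measurable_EFinP; rewrite /exp_coeff /=; apply: measurable_funM => //.
  exact: measurable_funX.
have -> : \int[P]_w (expR (Y w))%:E = \int[P]_w (\sum_(n <oo) f n w).
  apply: eq_integral => w _; rewrite /expR -EFin_lim; last exact: is_cvg_series_exp_coeff.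
  by apply: congr_lim; apply/funext => n; rewrite /= /series /= -sumEFin.
rewrite integral_nneseries //.
apply: lime_le; first by apply: is_cvg_nneseries => n _ _; exact: integral_ge0.
apply: nearW => N; apply: (@le_trans _ _ (\sum_(0 <= i < N) ((2^-1) ^+ i)%:E)); last first.
  by rewrite sumEFin lee_fin big_mkord sum_half_le2.
apply: lee_sum => n _; have [->|n0] := posnP n.
  have -> : \int[P]_w f 0%N w = \int[P]_w cst 1 w.
    by apply: eq_integral => w _; rewrite /f /exp_coeff /= expr0 fact0 divr1.
  by rewrite integral_cst // mul1e expr0; exact: probability_le1.
have qp : (0 < (8 * Q) ^+ n * n`!%:R)%R by rewrite mulr_gt0 ?exprn_gt0 ?mulr_gt0 // ltr0n fact_gt0.
have -> : \int[P]_w f n w = (((8 * Q) ^+ n * n`!%:R)^-1)%:E * \int[P]_w (`|X w| ^+ n)%:E.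
  rewrite -ge0_integralZl_EFin //.
  - apply: eq_integral => w _; rewrite /f /exp_coeff /Y /= -EFinM; congr EFin.
    by rewrite expr_div_n invfM; ring.
  - by apply/measurable_EFinP; apply: measurable_funX; exact: measurableT_comp.
  - by rewrite invr_ge0 ltW.
rewrite lee_pdivrMl // (le_trans (psi1_moment mX XQ n0 (ltW Q0))) //.
rewrite -EFinM lee_fin !exprMn.
have e : (8 ^+ n * 2^-1 ^+ n = 4 ^+ n :> R)%R by rewrite -exprMn; congr (_ ^+ n)%R; field.
have -> : (8 ^+ n * Q ^+ n * n`!%:R * 2^-1 ^+ n = 8 ^+ n * 2^-1 ^+ n * n`!%:R * Q ^+ n)%R by ring.
rewrite e.
by rewrite ler_wpM2r ?exprn_ge0 ?powers_le_fact // ltW.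
Qed.

End psi1.

(** * The uniform dither *)

Section uniform.
Context {R : realType} (lambda : R) (l0 : 0 < lambda).
Let U := uniform_prob (gtrN l0).

(** The last hypothesis describes only the trace of the interval on [-lambda, lambda], so half-lines
    are covered as well. *)
Lemma uniform_prob_itv (i : interval R) (x y : R) : -lambda <= x -> x <= y -> y <= lambda ->
  (forall t, (t \in i) && (- lambda <= t <= lambda) = (x <= t <= y)) ->
  U [set` i] = ((y - x) / (2 * lambda))%:E.
Proof.
move=> lx xy yl H; rewrite /U /uniform_prob integral_uniform_pdf.
have -> : [set` i] `&` `[- lambda, lambda]%classic = `[x, y]%classic.
  apply/seteqP; split => t.
    by move=> [ti tl]; rewrite /= in_itv /= -H; apply/andP; split.
  by rewrite /= in_itv /= -H => /andP[ti tl]; split.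
rewrite (eq_integral (cst ((2 * lambda)^-1)%:E)) => [|t]; last first.
  rewrite inE /= in_itv /= -H => /andP[_ tl]; rewrite /uniform_pdf tl opprK.
  by congr (_^-1)%:E; ring.
rewrite integral_cst //= lebesgue_measure_itv /= lte_fin.
case: ltP => [_|yx]; first by rewrite EFinN -EFinD -EFinM mulrC.
have -> : y = x by apply/eqP; rewrite eq_le xy yx.
by rewrite mule0 subrr mul0r.
Qed.

(** Here 2 p - 1 is the mean of the dithered sign. For |z| <= lambda, lambda times this mean is
    exactly z; otherwise both are at most |z| in absolute value. *)
Lemma uniform_prob_sign z : exists2 p : R, 0 <= p <= 1 &
  U [set t | 0 <= z + t] = p%:E /\
  `|lambda * (2 * p - 1) - z| <= 2 * `|z| * ((lambda < `|z|)%R)%:R.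
Proof.
have E : [set t | 0 <= z + t] = [set` `[- z, +oo[].
  by apply/seteqP; split => t /=; rewrite in_itv /= andbT; lra.
have [zl|zl] := leP `|z| lambda.
  have /andP[z1 z2] : - lambda <= z <= lambda by rewrite -ler_norml.
  exists ((lambda + z) / (2 * lambda)).
    by apply/andP; split; [apply: divr_ge0|rewrite ler_pdivrMr ?mulr_gt0 //]; lra.
  split.
    rewrite E; have -> : lambda + z = lambda - - z by rewrite opprK.
    apply: uniform_prob_itv; [lra|lra|exact: lexx|move=> t].
    by rewrite in_itv /= andbT; apply/andP/andP => -[]; lra.
  rewrite (_ : lambda * _ - z = 0) ?normr0 ?mulr_ge0 //.
  by field; rewrite gt_eqF.
exists (fine (U [set t | 0 <= z + t])).
  have mS : measurable [set t | 0 <= z + t] by rewrite E.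
  rewrite fine_ge0 //= -lee_fin fineK ?fin_num_measure //.
  exact: probability_le1.
have mS : measurable [set t | 0 <= z + t] by rewrite E.
split; first by rewrite fineK ?fin_num_measure.
set p := fine _.
have p0 : 0 <= p by rewrite fine_ge0.
have p1 : p <= 1.
  by rewrite -lee_fin fineK ?fin_num_measure //; exact: probability_le1.
rewrite mulr1 (le_trans (ler_normB _ _)) //.
have h : `|lambda * (2 * p - 1)| <= lambda.
  rewrite normrM (gtr0_norm l0) -[leRHS]mulr1 ler_pM2l //.
  by rewrite ler_norml; lra.
lra.
Qed.

(** An interval of length 2 r under the density 1 / (2 lambda); this bounds the conditional
    probability of a flip. *)
Lemma uniform_prob_small z r : 0 <= r ->
  (U [set t | (`|z + t| <= r)%R] <= (r / lambda)%:E)%E.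
Proof.
move=> r0.
have E : [set t | `|z + t| <= r] = [set` `[- z - r, r - z]].
  by apply/seteqP; split => t /=; rewrite in_itv /= ler_norml; lra.
have [h1|h1] := leP (Num.max (- lambda) (- z - r)) (Num.min lambda (r - z)).
  rewrite E (@uniform_prob_itv _ (Num.max (- lambda) (- z - r)) (Num.min lambda (r - z))) //.
  - rewrite lee_fin invfM mulrA ler_wpM2r ?invr_ge0 ?(ltW l0) //.
    rewrite ler_pdivrMr //.
    have h2 : Num.min lambda (r - z) <= r - z by rewrite ge_min lexx orbT.
    have h3 : - z - r <= Num.max (- lambda) (- z - r) by rewrite le_max lexx orbT.
    lra.
  - by rewrite le_max lexx.
  - by rewrite ge_min lexx.
  - by move=> t; rewrite in_itv /= ge_max le_min; apply/andP/andP => -[/andP[? ?] /andP[? ?]]; split; apply/andP; split; lra.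
rewrite [X in (X <= _)%E](_ : _ = 0%E) ?lee_fin ?divr_ge0 // 1?ltW //.
rewrite /U /uniform_prob integral_uniform_pdf E.
rewrite [X in integral _ X](_ : _ = set0) ?integral_set0 //.
apply/seteqP; split => t //=; rewrite !in_itv /= => -[/andP[? ?] /andP[? ?]].
by move: h1; rewrite ltNge => /negP; apply; rewrite ge_max !le_min; apply/andP; split; apply/andP; split; lra.
Qed.

End uniform.

(** * Means *)

Lemma normM_le_sqr (R : realDomainType) (x y : R) : `|x * y| <= x ^+ 2 + y ^+ 2.
Proof.
have h1 := sqr_ge0 (x + y); have h2 := sqr_ge0 (x - y).
by rewrite sqrrD in h1; rewrite sqrrB in h2; rewrite ler_norml; lra.
Qed.

Section means.
Context d (T : measurableType d) (R : realType) (P : probability T R).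
Implicit Types f g : T -> R.

(** Integrability and value travel together, so that means of linear combinations need no separate
    side conditions. *)
Definition has_mean f (v : R) : Prop :=
  P.-integrable setT (EFin \o f) /\ (\int[P]_w (f w)%:E = v%:E)%E.

Lemma has_mean_measurable f v : has_mean f v -> measurable_fun setT f.
Proof. by case=> /integrableP[/measurable_EFinP]. Qed.

Lemma has_mean_ext f g v : f =1 g -> has_mean f v -> has_mean g v.
Proof. by move=> /funext ->. Qed.

Lemma has_mean_cst (c : R) : has_mean (fun=> c) c.
Proof.
split; first exact: finite_measure_integrable_cst.
by rewrite /= integral_cst //= probability_setT mule1.
Qed.

Lemma has_meanD f g u v :
  has_mean f u -> has_mean g v -> has_mean (fun w => f w + g w) (u + v).
Proof.
move=> [f1 f2] [g1 g2]; split.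
  have -> : EFin \o (fun w => f w + g w) = (EFin \o f) \+ (EFin \o g) by [].
  exact: integrableD.
under eq_integral do rewrite EFinD.
by rewrite integralD // f2 g2.
Qed.

Lemma has_meanZ (c : R) f u : has_mean f u -> has_mean (fun w => c * f w) (c * u).
Proof.
move=> [f1 f2]; split.
  have -> : EFin \o (fun w => c * f w) = fun w => (c%:E * (EFin \o f) w)%E by [].
  exact: integrableZl.
under eq_integral do rewrite EFinM.
by rewrite integralZl // f2.
Qed.

Lemma has_mean_sum (I : Type) (s : seq I) (f : I -> T -> R) (u : I -> R) :
  (forall i, has_mean (f i) (u i)) ->
  has_mean (fun w => \sum_(i <- s) f i w) (\sum_(i <- s) u i).
Proof.
move=> H; elim: s => [|i s IH].
  by rewrite big_nil; apply: has_mean_ext (has_mean_cst 0) => w; rewrite big_nil.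
rewrite big_cons; apply: has_mean_ext (has_meanD (H i) IH) => w.
by rewrite big_cons.
Qed.

Lemma has_mean_le f (M : R) : measurable_fun setT f -> (forall w, 0 <= f w) ->
  (\int[P]_w (f w)%:E <= M%:E)%E -> exists2 v, v <= M & has_mean f v.
Proof.
move=> mf f0 fM.
have I0 : (0 <= \int[P]_w (f w)%:E)%E by apply: integral_ge0 => w _; rewrite lee_fin.
have fin : (\int[P]_w (f w)%:E)%E \is a fin_num.
  by rewrite ge0_fin_numE // (le_lt_trans fM) // ltry.
exists (fine (\int[P]_w (f w)%:E)); first by rewrite -lee_fin fineK.
split; last by rewrite fineK.
apply/integrableP; split; first exact/measurable_EFinP.
rewrite (eq_integral (fun w => (f w)%:E)) ?(le_lt_trans fM) ?ltry // => w _.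
by rewrite gee0_abs // lee_fin.
Qed.

Lemma le_has_mean f g v : measurable_fun setT f -> (forall w, 0 <= f w) ->
  (forall w, f w <= g w) -> has_mean g v -> (\int[P]_w (f w)%:E <= v%:E)%E.
Proof.
move=> mf f0 fg Hg; have mg := has_mean_measurable Hg; case: Hg => _ <-.
by apply: ge0_le_integral => //; [move=> w _; rewrite lee_fin|exact/measurable_EFinP|
  exact/measurable_EFinP|move=> w _; rewrite lee_fin].
Qed.

Lemma has_mean_dominated f g v : measurable_fun setT f ->
  (forall w, `|f w| <= g w) -> has_mean g v -> exists u, has_mean f u.
Proof.
move=> mf fg [ig _].
have intf : P.-integrable setT (EFin \o f).
  apply: le_integrable ig => //; first exact/measurable_EFinP.
  by move=> w _; rewrite /= lee_fin (le_trans (fg w)) // ler_norm.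
exists (fine (\int[P]_w (f w)%:E)); split => //.
by rewrite fineK //; exact: integrable_fin_num.
Qed.

End means.

Section measurability.
Context {R : realType}.

Lemma measurable_vec_coord D d (T : measurableType d) (u : T -> D.-tuple R) i :
  measurable_fun setT u -> measurable_fun setT (fun w => vec (u w) i 0).
Proof.
move=> mu; apply: (eq_measurable_fun (fun w => tnth (u w) i)).
  by move=> w _; rewrite mxE.
exact: (measurableT_comp (measurable_tnth i)).
Qed.

Lemma measurable_dot D d (T : measurableType d) (u : T -> D.-tuple R) (t : 'cV[R]_D) :
  measurable_fun setT u -> measurable_fun setT (fun w => dot (vec (u w)) t).
Proof.
move=> mu; apply: measurable_sum => i; apply: measurable_funM => //.
exact: measurable_vec_coord.
Qed.

Lemma measurable_norm2 D d (T : measurableType d) (u : T -> D.-tuple R) :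
  measurable_fun setT u -> measurable_fun setT (fun w => norm2 (vec (u w))).
Proof.
move=> mu; apply: (measurableT_comp (f := @Num.sqrt R)).
  by apply: continuous_measurable_fun; exact: sqrt_continuous.
by apply: measurable_sum => i; apply: measurable_funM; exact: measurable_vec_coord.
Qed.

Lemma measurable_sign d (T : measurableType d) (f : T -> R) :
  measurable_fun setT f -> measurable_fun setT (fun w => sign (f w)).
Proof.
move=> mf; apply: measurable_fun_ifT => //.
by apply: measurable_fun_ler => //; exact: measurable_cst.
Qed.

End measurability.

(** * First and second moments of an isotropic vector *)

Section isotropic_moments.
Context d (T : measurableType d) (R : realType) (P : probability T R) (D : nat)
  (a : {RV P >-> D.-tuple R}) (xi : {RV P >-> R}).
Hypotheses (a_mean : mean_zero P a) (a_iso : isotropic P a).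

Let mtnth i : measurable_fun setT (fun w => vec (a w) i 0).
Proof. exact: measurable_vec_coord. Qed.

(** Isotropy gives the integrals. Integrability comes from the diagonal, where the integrand is
    nonnegative with integral 1, and extends by domination. *)
Lemma isotropic_coord i j :
  has_mean P (fun w => vec (a w) i 0 * vec (a w) j 0) (i == j)%:R.
Proof.
have E k l : (\int[P]_w (vec (a w) k 0 * vec (a w) l 0)%:E = ((k == l)%:R)%:E)%E.
  have := a_iso k l; rewrite unlock !mxE => <-.
  by apply: eq_integral => w _; rewrite !mxE big_ord1 !mxE.
have sq k : has_mean P (fun w => vec (a w) k 0 ^+ 2) 1.
  have [||v _ [v1 v2]] := @has_mean_le _ _ _ P (fun w => vec (a w) k 0 ^+ 2) 1 _ (fun w => sqr_ge0 _).
  - exact: measurable_funX.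
  - by under eq_integral do rewrite expr2; rewrite E eqxx.
  split => //; by under eq_integral do rewrite expr2; rewrite E eqxx.
have [||u [u1 u2]] := @has_mean_dominated _ _ _ P
    (fun w => vec (a w) i 0 * vec (a w) j 0) _ _ _ _ (has_meanD (sq i) (sq j)).
- exact: measurable_funM.
- by move=> w; exact: normM_le_sqr.
by split => //; rewrite E.
Qed.

Lemma isotropic_dot g h :
  has_mean P (fun w => dot (vec (a w)) g * dot (vec (a w)) h) (dot g h).
Proof.
have H i := has_mean_sum (index_enum 'I_D)
  (fun j => has_meanZ (g i 0 * h j 0) (isotropic_coord i j)).
have := has_mean_sum (index_enum 'I_D) H.
rewrite (_ : \sum_i _ = dot g h); last first.
  apply: eq_bigr => i _; rewrite (bigD1 i) //= eqxx mulr1 big1 ?addr0 //.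
  by move=> j /negbTE; rewrite eq_sym => ->; rewrite mulr0.
apply: has_mean_ext => w; rewrite /dot mulr_suml; apply: eq_bigr => i _.
by rewrite mulr_sumr; apply: eq_bigr => j _; ring.
Qed.

Lemma isotropic_sqr_norm2 : has_mean P (fun w => norm2 (vec (a w)) ^+ 2) D%:R.
Proof.
have := has_mean_sum (index_enum 'I_D) (fun i => isotropic_coord i i).
rewrite (_ : \sum_i _ = D%:R); last first.
  by under eq_bigr do rewrite eqxx; rewrite sumr_const card_ord.
by apply: has_mean_ext => w; rewrite sqr_norm2.
Qed.

(** Coordinatewise, the mean factors by independence and the mean of [a] vanishes; second moments
    supply integrability. *)
Lemma mean_indep_noise_dot (M : R) h :
  (forall A B, measurable A -> measurable B ->
     P (a @^-1` A `&` xi @^-1` B) = (P (a @^-1` A) * P (xi @^-1` B))%E) ->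
  has_mean P (fun w => xi w ^+ 2) M ->
  has_mean P (fun w => xi w * dot (vec (a w)) h) 0.
Proof.
move=> ind xi2.
have ai0 i : has_mean P (fun w => vec (a w) i 0) 0.
  have [||u [u1 u2]] := @has_mean_dominated _ _ _ P (fun w => vec (a w) i 0) _ _ _ _
    (has_meanD (has_mean_cst P 1) (isotropic_coord i i)).
  - exact: mtnth.
  - move=> w; rewrite -expr2 ler_norml.
    have := sqr_ge0 (vec (a w) i 0 - 1); have := sqr_ge0 (vec (a w) i 0 + 1).
    have := sqr_ge0 (vec (a w) i 0); rewrite sqrrD sqrrB; lra.
  by split => //; have := a_mean i; rewrite unlock.
have xai i : has_mean P (fun w => xi w * vec (a w) i 0) 0.
  have [||u [u1 u2]] := @has_mean_dominated _ _ _ P (fun w => xi w * vec (a w) i 0) _ _ _ _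
    (has_meanD xi2 (isotropic_coord i i)).
  - by apply: measurable_funM => //; exact: mtnth.
  - by move=> w; rewrite -expr2; exact: normM_le_sqr.
  split => //.
  have := @integral_indep_pair_mul _ _ _ P _ _ _ _ xi a id (fun t => vec t i 0).
  apply => //.
  - by move=> A B mA mB; rewrite setIC ind // muleC.
  - exact: measurable_vec_coord.
  - by case: (ai0 i).
  - by case: (ai0 i).
have := has_mean_sum (index_enum 'I_D) (fun i => has_meanZ (h i 0) (xai i)).
rewrite (_ : \sum_i _ = 0); last by rewrite big1 // => i _; rewrite mulr0.
apply: has_mean_ext => w; rewrite /dot mulr_sumr; apply: eq_bigr => i _; ring.
Qed.

End isotropic_moments.

(** * Moment generating functions of a single measurement *)

Section pointwise.
Context {R : realType}.
Implicit Types b lambda theta x y z p : R.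

(** For x >= 0 it follows from exp(x) (1 - x) <= 1, multiplied by x; for x = -y < 0 from exp(-y) <=
    1 / (1 + y) = 1 - y + y^2 / (1 + y). *)
Lemma expR_quadratic x : expR x <= 1 + x + x ^+ 2 * expR `|x|.
Proof.
have [x0|x0] := leP 0 x.
  have e1 : expR x * (1 - x) <= 1.
    rewrite -[leRHS](mulfV (lt0r_neq0 (expR_gt0 x))) ler_wpM2l ?expR_ge0 //.
    by rewrite -expRN; exact: expR_ge1Dx.
  have : x * (expR x * (1 - x)) <= x * 1 by rewrite ler_wpM2l.
  rewrite (ger0_norm x0); lra.
pose y := - x; have xE : x = - y by rewrite opprK.
have y0 : 0 < y by rewrite oppr_gt0.
have h1 : 1 + y <= expR y := expR_ge1Dx y.
have y1 : 0 < 1 + y by rewrite ltr_wpDl.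
have h : expR x <= (1 + y)^-1 by rewrite xE expRN lef_pV2 ?posrE ?expR_gt0.
have h2 : (1 + y)^-1 = 1 - y + y ^+ 2 * (1 + y)^-1 by field; rewrite gt_eqF.
have h3 : y ^+ 2 * (1 + y)^-1 <= y ^+ 2 * expR y.
  rewrite ler_wpM2l ?sqr_ge0 // (le_trans (_ : _ <= 1)) //; first by rewrite invf_le1 // lerDl ltW.
  by rewrite (le_trans _ h1) // lerDl ltW.
rewrite xE normrN sqrrN gtr0_norm //; rewrite xE in h; lra.
Qed.

Lemma two_point_exp p y : 0 <= p <= 1 ->
  p * expR y + (1 - p) * expR (- y) <= 1 + (2 * p - 1) * y + y ^+ 2 * expR `|y|.
Proof.
move=> /andP[p0 p1]; have h1 := expR_quadratic y; have h2 := expR_quadratic (- y).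
rewrite normrN sqrrN in h2.
have q1 : 0 <= 1 - p by lra.
have := ler_wpM2l p0 h1; have := ler_wpM2l q1 h2; lra.
Qed.

Lemma sqr_le_expR_scale b y : 0 < b -> y ^+ 2 <= 2 * b ^+ 2 * expR (`|y| / b).
Proof.
move=> b0; have yb : 0 <= `|y| / b by rewrite divr_ge0 // ltW.
have := sqr_le_expR yb.
by rewrite expr_div_n real_normK ?num_real // ler_pdivrMr ?exprn_gt0 //; lra.
Qed.

(** The square costs exp(|z| / (2 b)); where |z| > lambda, the other half of the exponent yields the
    factor exp(- lambda / (2 b)). *)
Lemma truncated_sqr_le b lambda z : 0 < b ->
  z ^+ 2 * ((lambda < `|z|)%R)%:R <=
  8 * b ^+ 2 * expR (- (lambda / (2 * b))) * expR (`|z| / b).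
Proof.
move=> b0; case: ltP => [lz|_]; last first.
  by rewrite mulr0n mulr0; do ?apply: mulr_ge0; rewrite ?expR_ge0 ?exprn_ge0 // ltW.
rewrite mulr1; have b20 : 0 < 2 * b by rewrite mulr_gt0.
apply: le_trans (sqr_le_expR_scale z b20) _.
have -> : 2 * (2 * b) ^+ 2 = 8 * b ^+ 2 by ring.
rewrite -[leRHS]mulrA -expRD ler_wpM2l ?mulr_ge0 ?exprn_ge0 ?(ltW b0) // ler_expR.
rewrite -(ler_pM2r b20).
have -> : `|z| / (2 * b) * (2 * b) = `|z| by field; rewrite gt_eqF.
have -> : (- (lambda / (2 * b)) + `|z| / b) * (2 * b) = 2 * `|z| - lambda.
  by field; rewrite gt_eqF.
lra.
Qed.

(** Below lambda the exponential is at most e <= 4. Above it, theta <= 1 / (4 b), so the square and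
    the exponential together use exp(|y| / (2 b)), and the rest of exp(|y| / b) pays for the tail
    factor. *)
Lemma sqr_expR_le b lambda theta y : 0 < b -> 4 * b <= lambda ->
  0 <= theta -> theta * lambda <= 1 ->
  y ^+ 2 * expR (theta * `|y|) <=
  4 * y ^+ 2 + 32 * b ^+ 2 * expR (- (lambda / (2 * b))) * expR (`|y| / b).
Proof.
move=> b0 bl t0 tl; have b40 : 0 < 4 * b by rewrite mulr_gt0.
have l0 : 0 < lambda by apply: lt_le_trans bl.
have [yl|yl] := leP `|y| lambda.
  have h : expR (theta * `|y|) <= 4.
    apply: le_trans expR1_le4; rewrite ler_expR (le_trans _ tl) // ler_wpM2l //.
  have := ler_wpM2l (sqr_ge0 y) h.
  have : 0 <= 32 * b ^+ 2 * expR (- (lambda / (2 * b))) * expR (`|y| / b).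
    by do ?apply: mulr_ge0; rewrite ?expR_ge0 ?exprn_ge0 // ltW.
  lra.
suff : y ^+ 2 * expR (theta * `|y|) <=
    32 * b ^+ 2 * expR (- (lambda / (2 * b))) * expR (`|y| / b).
  by have := sqr_ge0 y; lra.
have h1 := sqr_le_expR_scale y b40.
have h2 : expR (theta * `|y|) <= expR (`|y| / (4 * b)).
  rewrite ler_expR mulrC ler_wpM2l //.
  by rewrite -(ler_pM2r l0) (le_trans tl) // mulrC ler_pdivlMr // mul1r.
apply: le_trans (ler_pM (sqr_ge0 y) (expR_ge0 _) h1 h2) _.
have -> : 2 * (4 * b) ^+ 2 = 32 * b ^+ 2 by ring.
rewrite -[leLHS]mulrA -[leRHS]mulrA -!expRD ler_wpM2l ?mulr_ge0 ?exprn_ge0 ?(ltW b0) // ler_expR.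
rewrite -(ler_pM2r b40).
have -> : (`|y| / (4 * b) + `|y| / (4 * b)) * (4 * b) = 2 * `|y| by field; rewrite gt_eqF.
have -> : (- (lambda / (2 * b)) + `|y| / b) * (4 * b) = 4 * `|y| - 2 * lambda by field; rewrite gt_eqF.
lra.
Qed.

Lemma weighted_amgm kap x y : 0 < kap -> 2 * x * y <= kap * y ^+ 2 + kap^-1 * x ^+ 2.
Proof.
move=> k0; rewrite -subr_ge0.
rewrite (_ : _ - _ = kap^-1 * (kap * y - x) ^+ 2); last by field; rewrite gt_eqF.
by apply: mulr_ge0; [rewrite invr_ge0 ltW|exact: sqr_ge0].
Qed.

(* Averaging [expR (s * lambda * sign (z + tau) * x)] over the dither. *)
Lemma one_bit_average b lambda s kap p x z K : 0 < b -> 4 * b <= lambda ->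
  0 <= s -> s * lambda * lambda <= 1 -> 0 < kap -> 0 <= p <= 1 ->
  `|lambda * (2 * p - 1) - z| <= 2 * `|z| * ((lambda < `|z|)%R)%:R ->
  K = 8 * b ^+ 2 * expR (- (lambda / (2 * b))) ->
  p * expR (s * lambda * x) + (1 - p) * expR (- (s * lambda * x)) <=
  1 + s * (z * x) + s * (kap * x ^+ 2) + s * (kap^-1 * K * expR (`|z| / b)) +
  (s * lambda) ^+ 2 * (4 * x ^+ 2) + (s * lambda) ^+ 2 * (4 * K * expR (`|x| / b)).
Proof.
move=> b0 bl s0 sll k0 p01 pz KE.
have l0 : 0 < lambda by apply: lt_le_trans bl; rewrite mulr_gt0.
have sl0 : 0 <= s * lambda by apply: mulr_ge0 => //; exact: ltW.
apply: le_trans (two_point_exp (s * lambda * x) p01) _.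
have t1 : (s * lambda * x) ^+ 2 * expR `|s * lambda * x| <=
    (s * lambda) ^+ 2 * (4 * x ^+ 2 + 4 * K * expR (`|x| / b)).
  rewrite normrM (ger0_norm sl0) [in leLHS]exprMn -[leLHS]mulrA.
  apply: ler_wpM2l; first exact: sqr_ge0.
  have -> : 4 * K = 32 * b ^+ 2 * expR (- (lambda / (2 * b))) by rewrite KE; ring.
  exact: sqr_expR_le.
(* The dither bias is present only for |z| > lambda; the weight [kap] decouples z from x. *)
have t2 : (lambda * (2 * p - 1) - z) * x <=
    kap * x ^+ 2 + kap^-1 * (z ^+ 2 * ((lambda < `|z|)%R)%:R).
  have : (lambda * (2 * p - 1) - z) * x <= 2 * `|z| * ((lambda < `|z|)%R)%:R * `|x|.
    by rewrite (le_trans (ler_norm _)) // normrM; apply: ler_wpM2r.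
  move/le_trans; apply.
  case: (lambda < `|z|) => /=; last first.
    rewrite mulr0n !mulr0 mul0r addr0; apply: mulr_ge0; [exact: ltW|exact: sqr_ge0].
  rewrite !mulr1 -(real_normK (num_real x)) -(real_normK (num_real z)).
  exact: weighted_amgm.
have t3 : kap^-1 * (z ^+ 2 * ((lambda < `|z|)%R)%:R) <= kap^-1 * (K * expR (`|z| / b)).
  by apply: ler_wpM2l; [rewrite invr_ge0 ltW|rewrite KE; exact: truncated_sqr_le].
have t4 := ler_wpM2l s0 (le_trans t2 (lerD (lexx _) t3)).
move: t1 t4; lra.
Qed.

(** The two bias terms cost s eps / 64 each; the two quadratic terms cost 16 and 1 times (s
    lambda)^2. *)
Lemma one_bit_budget eps s lambda c hh K kap v1 v2 : 0 <= s -> 0 < eps -> eps < 1 ->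
  kap = eps / 256 -> 0 <= K -> K <= 8 * (eps / 512) ^+ 2 -> hh <= 4 -> v1 <= 2 -> v2 <= 2 ->
  1 + s * c + s * (kap * hh) + s * (kap^-1 * K * v2) +
  (s * lambda) ^+ 2 * (4 * hh) + (s * lambda) ^+ 2 * (4 * K * v1) <=
  1 + (s * c + s * eps / 32 + 17 * (s * lambda) ^+ 2).
Proof.
move=> s0 e0 e1 kE K0 Kle hle v1le v2le.
have k0 : 0 < kap by rewrite kE divr_gt0.
have sq := sqr_ge0 (s * lambda).
have a1 : s * (kap * hh) <= s * (eps / 64).
  by apply: ler_wpM2l => //; rewrite kE; have := ler_wpM2l (ltW e0) hle; lra.
have K2 : K <= eps ^+ 2 / (32 * 32 * 32) by move: Kle; rewrite expr_div_n; lra.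
have a2 : s * (kap^-1 * K * v2) <= s * (eps / 64).
  apply: ler_wpM2l => //; rewrite -mulrA mulrC ler_pdivrMr // kE.
  by have := ler_wpM2l K0 v2le; move: K2; rewrite expr2; lra.
have a3 : (s * lambda) ^+ 2 * (4 * hh) <= (s * lambda) ^+ 2 * 16.
  by apply: ler_wpM2l => //; lra.
have a4 : (s * lambda) ^+ 2 * (4 * K * v1) <= (s * lambda) ^+ 2 * 1.
  apply: ler_wpM2l => //.
  have : eps ^+ 2 <= 1 by rewrite expr_le1 // ltW.
  by have := ler_wpM2l K0 v1le; lra.
move: a1 a2 a3 a4; lra.
Qed.

End pointwise.

Section measurement_mgf.
Context d (T : measurableType d) (R : realType) (P : probability T R) (D : nat)
  (a : {RV P >-> D.-tuple R}) (xi tau : {RV P >-> R}).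
Variables (lambda : R) (lambda_gt0 : 0 < lambda).
Hypotheses (a_mean : mean_zero P a) (a_iso : isotropic P a).
Hypothesis tau_unif : forall S : set R, measurable S ->
  distribution P tau S = uniform_prob (gtrN lambda_gt0) S.
Hypothesis indep : mutually_independent P
  (tnth [tuple sigma_of a; sigma_of xi; sigma_of tau]).
(** [b] is a common scale for the exponential moments of <a, h> and <a, g> + xi; the radii 2 and 2
    rho leave room for net points just outside the balls. *)
Variables (b rho : R) (b_gt0 : 0 < b) (b_le : 4 * b <= lambda).
Hypothesis dot_exp : forall h, norm2 h <= 2 ->
  (\int[P]_w (expR (`|dot (vec (a w)) h| / b))%:E <= 2%:E)%E.
Hypothesis signal_exp : forall g, norm2 g <= 2 * rho ->
  (\int[P]_w (expR (`|dot (vec (a w)) g + xi w| / b))%:E <= 2%:E)%E.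
Hypothesis rho_ge0 : 0 <= rho.

Let indep_axi A B : measurable A -> measurable B ->
  P (a @^-1` A `&` xi @^-1` B) = (P (a @^-1` A) * P (xi @^-1` B))%E.
Proof.
move=> mA mB; have := mutually_independent3 indep (sigma_of_preimage a mA)
  (sigma_of_preimage xi mB) (sigma_of_preimage tau measurableT).
rewrite !preimage_setT setIT probability_setT mule1; apply => //;
  exact: measurable_preimageT.
Qed.

Let law := distribution P tau.

(** The dither is averaged with (a, xi) frozen, which the probabilities of the uniform law
    require. *)
Lemma integral_over_tau (f : D.-tuple R * R * R -> \bar R) :
  measurable_fun setT f -> (forall z, 0 <= f z)%E ->
  (\int[P]_w f (a w, xi w, tau w) = \int[P]_w \int[law]_t f (a w, xi w, t))%E.
Proof.
move=> mf f0.
rewrite (integral_indep_pair (X := pair_mfun a xi) (Y := tau)) //.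
apply: indep_pair_third => A B C mA mB mC.
by apply: (mutually_independent3 indep); try exact: sigma_of_preimage;
  exact: measurable_preimageT.
Qed.

Let mdot g : measurable_fun setT (fun w => dot (vec (a w)) g).
Proof. exact: measurable_dot. Qed.

Let noise_second_moment : exists M, has_mean P (fun w => xi w ^+ 2) M.
Proof.
(* At g = 0 the hypothesis [signal_exp] is an exponential moment of the noise alone. *)
have n0 : norm2 (0 : 'cV[R]_D) <= 2 * rho by rewrite norm20 mulr_ge0.
have [|v _ Hv] := has_mean_le _ (fun w => expR_ge0 _) (signal_exp n0).
  apply: measurableT_comp => //; apply: measurable_funM => //.
  by apply: measurableT_comp => //; apply: measurable_funD.
have [||u Hu] := @has_mean_dominated _ _ _ P (fun w => xi w ^+ 2) _ _ _ _
   (has_meanZ (2 * b ^+ 2) Hv).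
- exact: measurable_funX.
- move=> w; rewrite -(scale0r (0 : 'cV_D)) dotZr mul0r add0r ger0_norm ?sqr_ge0 //.
  exact: sqr_le_expR_scale.
by exists u.
Qed.

Let mean_signal_dot g h :
  has_mean P (fun w => (dot (vec (a w)) g + xi w) * dot (vec (a w)) h) (dot g h).
Proof.
have [M HM] := noise_second_moment.
have := has_meanD (isotropic_dot a_iso g h) (mean_indep_noise_dot a_mean a_iso h indep_axi HM).
by rewrite addr0; apply: has_mean_ext => w; rewrite mulrDl.
Qed.


Let mean_dot_exp h : norm2 h <= 2 ->
  exists2 v, v <= 2 & has_mean P (fun w => expR (`|dot (vec (a w)) h| / b)) v.
Proof.
move=> h2; apply: has_mean_le (dot_exp h2) => [|w]; last exact: expR_ge0.
apply: measurableT_comp => //; apply: measurable_funM => //.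
by apply: measurableT_comp => //; exact: mdot.
Qed.

Let mean_signal_exp g : norm2 g <= 2 * rho ->
  exists2 v, v <= 2 & has_mean P (fun w => expR (`|dot (vec (a w)) g + xi w| / b)) v.
Proof.
move=> g2; apply: has_mean_le (signal_exp g2) => [|w]; last exact: expR_ge0.
apply: measurableT_comp => //; apply: measurable_funM => //.
by apply: measurableT_comp => //; exact: measurable_funD.
Qed.

Let measurable_over_tau (f : D.-tuple R * R * R -> \bar R) :
  measurable_fun setT f -> (forall z, 0 <= f z)%E ->
  measurable_fun setT (fun w => \int[law]_t f (a w, xi w, t))%E.
Proof.
move=> mf f0.
have mp : measurable_fun setT (fun w => (a w, xi w)) by exact: measurable_fun_pair.
have := @measurable_fun_fubini_tonelli_F _ _ _ _ R (distribution P tau) f mf f0.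
by move=> /measurableT_comp/(_ mp).
Qed.

Let integral_two_point (S : set R) (p u v : R) : measurable S -> law S = p%:E ->
  0 <= u -> 0 <= v ->
  (\int[law]_t (if t \in S then u else v)%:E = (p * u + (1 - p) * v)%:E)%E.
Proof.
move=> mS US u0 v0.
have -> : (\int[law]_t (if t \in S then u else v)%:E =
    \int[law]_t ((u%:E * (\1_S t)%:E) + (v%:E * (\1_(~` S) t)%:E)))%E.
  apply: eq_integral => t _; rewrite !indicE in_setC.
  by case: (t \in S); rewrite /= ?mule1 ?mule0 ?adde0 ?add0e.
have mI S' : measurable S' -> measurable_fun setT (fun t : R => (\1_S' t : R)%:E).
  by move=> ?; exact/measurable_EFinP/measurable_indic.
have mSC := measurableC mS.
rewrite ge0_integralD //; last 4 first.
- by move=> t _; rewrite mule_ge0 ?lee_fin.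
- by apply: measurable_funeM; exact: mI.
- by move=> t _; rewrite mule_ge0 ?lee_fin.
- by apply: measurable_funeM; exact: mI.
rewrite !ge0_integralZl_EFin //; try exact: mI.
rewrite !integral_indic // !setIT.
transitivity (u%:E * law S + v%:E * law (~` S))%E; first by [].
have -> : (law (~` S) = 1 - law S)%E by exact: probability_setC.
by rewrite US -EFinB -!EFinM -EFinD (mulrC u) (mulrC v).
Qed.

Variable eps : R.
Hypotheses (eps_gt0 : 0 < eps) (eps_lt1 : eps < 1) (lambda_ge1 : 1 <= lambda).
Hypothesis tail_le : b ^+ 2 * expR (- (lambda / (2 * b))) <= (eps / 512) ^+ 2.

(** Averaging over the dither leaves (<a, g> + xi) <a, h>, whose mean <g, h> cancels the centring.
    The factor s = eps / (1024 lambda^2) is small enough for the quadratic terms and the bias to use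
    only part of the margin s eps / 16. *)
Lemma mgf_one_bit g h : norm2 g <= 2 * rho -> norm2 h <= 2 ->
  (\int[P]_w (expR (eps / (32 * 32 * lambda ^+ 2) *
      (lambda * one_bit (vec (a w)) (xi w) (tau w) g * dot (vec (a w)) h
       - dot g h - eps / 16)))%:E
   <= (expR (- ((eps / lambda) ^+ 2 / (512 * 256))))%:E)%E.
Proof.
move=> gr h2; set s := eps / (32 * 32 * lambda ^+ 2); set c := dot g h.
have lne : lambda != 0 by rewrite gt_eqF.
have s0 : 0 <= s.
  by apply: divr_ge0; [exact: ltW|apply: mulr_ge0 => //; exact: sqr_ge0].
pose q := eps / lambda.
have q0 : 0 < q by rewrite divr_gt0.
have q1 : q <= 1 by rewrite ler_pdivrMr // mul1r (le_trans (ltW eps_lt1)).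
have sE : s * eps = q ^+ 2 / (32 * 32) by rewrite /s /q; field.
have slE : s * lambda = q / (32 * 32) by rewrite /s /q; field.
have sl0 : 0 <= s * lambda by rewrite mulr_ge0 // ltW.
have sll : s * lambda * lambda <= 1.
  by rewrite slE /q mulrAC divfK //; have := ltW eps_lt1; lra.
rewrite -/q; clearbody s q.
pose X w := dot (vec (a w)) h; pose z w := dot (vec (a w)) g + xi w.
pose f (q : D.-tuple R * R * R) := (expR (s * (lambda * sign (dot (vec q.1.1) g + q.1.2 + q.2)
   * dot (vec q.1.1) h - c - eps / 16)))%:E.
have mf : measurable_fun setT f.
  have m11 : measurable_fun setT (fun q : D.-tuple R * R * R => q.1.1).
    by apply: measurableT_comp => //; exact: measurable_fst.
  apply/measurable_EFinP; apply: measurableT_comp => //; apply: measurable_funM => //.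
  apply: measurable_funB => //; apply: measurable_funB => //.
  apply: measurable_funM; last exact: measurable_dot.
  apply: measurable_funM => //; apply: measurable_sign.
  apply: measurable_funD => //; apply: measurable_funD; first exact: measurable_dot.
  by apply: measurableT_comp => //; exact: measurable_fst.
rewrite (_ : integral _ _ _ = \int[P]_w f (a w, xi w, tau w))%E //.
rewrite integral_over_tau //; last by move=> ?; rewrite lee_fin expR_ge0.
pose K := 8 * b ^+ 2 * expR (- (lambda / (2 * b))).
have K0 : 0 <= K by do ?apply: mulr_ge0; rewrite ?expR_ge0 ?exprn_ge0 // ltW.
have Kle : K <= 8 * (eps / 512) ^+ 2 by rewrite /K -mulrA ler_pM2l.
pose kap := eps / 256.
have kap0 : 0 < kap by rewrite divr_gt0.
have [v1 v1le H1] := mean_dot_exp h2.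
have [v2 v2le H2] := mean_signal_exp gr.
have H0 : has_mean P (fun w => X w ^+ 2) (dot h h) := isotropic_dot a_iso h h.
(* [G] majorises the dither average for fixed (a, xi), up to the factor [E0]; [B] is its mean. *)
pose G w := 1 + s * (z w * X w) + s * (kap * X w ^+ 2) +
  s * (kap^-1 * K * expR (`|z w| / b)) +
  (s * lambda) ^+ 2 * (4 * X w ^+ 2) + (s * lambda) ^+ 2 * (4 * K * expR (`|X w| / b)).
pose B := 1 + s * c + s * (kap * dot h h) + s * (kap^-1 * K * v2) +
  (s * lambda) ^+ 2 * (4 * dot h h) + (s * lambda) ^+ 2 * (4 * K * v1).
pose E0 := expR (- (s * c) - s * (eps / 16)).
have E00 : 0 < E0 := expR_gt0 _.
have HG : has_mean P (fun w => E0 * G w) (E0 * B).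
  apply: has_meanZ; do ?apply: has_meanD; do ?apply: has_meanZ => //.
  - exact: has_mean_cst.
  - exact: mean_signal_dot.
pose S w := [set t : R | 0 <= z w + t].
have mS w : measurable (S w).
  rewrite -[X in measurable X]setTI; apply: measurable_fun_ler => //.
  exact: measurable_funD.
have inner w : exists2 v, v <= E0 * G w & 0 <= v /\
    (\int[law]_t f (a w, xi w, t))%E = v%:E.
  have [p p01 [pE pz]] := uniform_prob_sign lambda_gt0 (z w).
  pose y := s * lambda * X w.
  pose v := p * (E0 * expR y) + (1 - p) * (E0 * expR (- y)).
  have [p0 p1] := andP p01.
  exists v; last split.
  - have -> : v = E0 * (p * expR y + (1 - p) * expR (- y)) by rewrite /v; ring.
    rewrite ler_pM2l //; exact: one_bit_average.
  - by apply: addr_ge0; apply: mulr_ge0 => //; [apply: mulr_ge0|rewrite subr_ge0|apply: mulr_ge0];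
      rewrite ?expR_ge0 ?(ltW E00).
  rewrite /v -(integral_two_point (mS w)); last 3 first.
  - by rewrite /law tau_unif.
  - by apply: mulr_ge0; [exact: ltW|exact: expR_ge0].
  - by apply: mulr_ge0; [exact: ltW|exact: expR_ge0].
  apply: eq_integral => t _; rewrite /f /= /sign.
  have -> : (t \in S w) = (0 <= dot (vec (a w)) g + xi w + t).
    by apply/idP/idP; rewrite inE.
  rewrite /E0 -!expRD.
  by case: ifP => _; congr (expR _)%:E; rewrite /y /X; ring.
apply: (@le_trans _ _ (E0 * B)%:E).
  apply: (@le_trans _ _ (\int[P]_w (E0 * G w)%:E)%E); last by case: HG => _ ->.
  apply: ge0_le_integral => //.
  - by move=> w _; have [v _ [v0 ->]] := inner w; rewrite lee_fin.
  - by apply: measurable_over_tau => // ?; rewrite lee_fin expR_ge0.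
  - by apply/measurable_EFinP; exact: has_mean_measurable HG.
  - by move=> w _; have [v vG [_ ->]] := inner w; rewrite lee_fin.
rewrite lee_fin.
have hh : dot h h <= 4.
  by rewrite -sqr_norm2 (_ : 4 = 2 ^+ 2) ?lerXn2r ?nnegrE ?norm2_ge0 //; ring.
have B1 : B <= 1 + (s * c + s * eps / 32 + 17 * (s * lambda) ^+ 2).
  exact: one_bit_budget.
apply: le_trans (_ : E0 * expR (s * c + s * eps / 32 + 17 * (s * lambda) ^+ 2) <= _).
  by rewrite ler_pM2l // (le_trans B1) // expR_ge1Dx.
(* With q = eps / lambda the exponent is q^2 (-1/2^14 + 1/2^15 + 17/2^20) = -15 q^2 / 2^20 <= -q^2 /
   2^17. *)
rewrite /E0 -expRD ler_expR slE.
have -> : s * (eps / 16) = q ^+ 2 / (32 * 32) / 16 by rewrite mulrA sE.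
rewrite sE expr_div_n; have := sqr_ge0 q; lra.
Qed.


(** Given (a, xi), the flip has probability at most delta |a| / lambda. Multiplied by exp(|<a, h>| /
    (2 b)), this splits by AM-GM into |a|^2, of mean D, and exp(|<a, h>| / b), of mean at most 2. *)
Lemma mgf_flip g h delta : (2 <= D)%N -> norm2 h <= 2 -> 0 <= delta ->
  (\int[P]_w (expR ((2 * b)^-1 *
      (if (`|dot (vec (a w)) g + xi w + tau w| <= delta * norm2 (vec (a w)))%R
       then `|dot (vec (a w)) h| else 0)))%:E
   <= (expR (delta / lambda * D%:R))%:E)%E.
Proof.
move=> D2 h2 delta0.
have b20 : 0 < 2 * b by rewrite mulr_gt0.
pose X w := dot (vec (a w)) h; pose z w := dot (vec (a w)) g + xi w.
pose N w := norm2 (vec (a w)).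
pose f (q : D.-tuple R * R * R) := (expR ((2 * b)^-1 *
  (if (`|dot (vec q.1.1) g + q.1.2 + q.2| <= delta * norm2 (vec q.1.1))%R
   then `|dot (vec q.1.1) h| else 0)))%:E.
have mf : measurable_fun setT f.
  have m11 : measurable_fun setT (fun q : D.-tuple R * R * R => q.1.1).
    by apply: measurableT_comp => //; exact: measurable_fst.
  apply/measurable_EFinP; apply: measurableT_comp => //; apply: measurable_funM => //.
  apply: measurable_fun_ifT => //; last first.
    by apply: measurableT_comp => //; exact: measurable_dot.
  apply: measurable_fun_ler; last by apply: measurable_funM => //; exact: measurable_norm2.
  apply: measurableT_comp => //.
  apply: measurable_funD => //; apply: measurable_funD; first exact: measurable_dot.
  by apply: measurableT_comp => //; exact: measurable_fst.
rewrite (_ : integral _ _ _ = \int[P]_w f (a w, xi w, tau w))%E //.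
rewrite integral_over_tau //; last by move=> ?; rewrite lee_fin expR_ge0.
have [v1 v1le H1] := mean_dot_exp h2.
pose c := delta / lambda.
have c0 : 0 <= c by apply: divr_ge0 => //; exact: ltW.
pose G w := 1 + c / 2 * (N w ^+ 2 + expR (`|X w| / b)).
have HG : has_mean P G (1 + c / 2 * (D%:R + v1)).
  apply: has_meanD; first exact: has_mean_cst.
  by apply: has_meanZ; apply: has_meanD => //; exact: isotropic_sqr_norm2.
pose S w := [set t : R | `|z w + t| <= delta * N w].
have mS w : measurable (S w).
  rewrite -[X in measurable X]setTI; apply: measurable_fun_ler => //.
  by apply: measurableT_comp => //; exact: measurable_funD.
have inner w : exists2 v, v <= G w & 0 <= v /\
    (\int[law]_t f (a w, xi w, t))%E = v%:E.
  have dN : 0 <= delta * N w by apply: mulr_ge0 => //; exact: norm2_ge0.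
  have := uniform_prob_small lambda_gt0 (z w) dN; rewrite -/(S w) => pS.
  have lS : law (S w) = uniform_prob (gtrN lambda_gt0) (S w) by rewrite /law tau_unif.
  have fS : law (S w) \is a fin_num by apply: fin_num_measure.
  pose p := fine (law (S w)).
  have pE : law (S w) = p%:E by rewrite fineK.
  have p0 : 0 <= p by rewrite -lee_fin -pE; exact: measure_ge0.
  have ple : p <= delta * N w / lambda by rewrite -lee_fin -pE lS.
  have p1 : p <= 1 by rewrite -lee_fin -pE; exact: probability_le1.
  pose u := expR ((2 * b)^-1 * `|X w|).
  have u0 : 0 <= u := expR_ge0 _.
  exists (p * u + (1 - p) * 1); last split.
  - have uu : u ^+ 2 = expR (`|X w| / b).
      by rewrite expr2 -expRD; congr expR; field; rewrite gt_eqF.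
    have nu : N w * u <= (N w ^+ 2 + u ^+ 2) / 2.
      by have := sqr_ge0 (N w - u); rewrite sqrrB; lra.
    have := ler_wpM2l c0 nu; have := ler_wpM2r u0 ple.
    rewrite (_ : delta * N w / lambda * u = c * (N w * u)); last by rewrite /c; ring.
    by rewrite /G -uu; lra.
  - by apply: addr_ge0; apply: mulr_ge0 => //; rewrite subr_ge0.
  rewrite -(integral_two_point (mS w)) //.
  apply: eq_integral => t _; rewrite /f /=.
  have -> : (t \in S w) = (`|dot (vec (a w)) g + xi w + t| <= delta * norm2 (vec (a w))).
    by apply/idP/idP; rewrite inE.
  by case: ifP => _ //; rewrite mulr0 expR0.
apply: (@le_trans _ _ (1 + c / 2 * (D%:R + v1))%:E).
  apply: (@le_trans _ _ (\int[P]_w (G w)%:E)%E); last by case: HG => _ ->.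
  apply: ge0_le_integral => //.
  - by move=> w _; have [v _ [v0 ->]] := inner w; rewrite lee_fin.
  - by apply: measurable_over_tau => // ?; rewrite lee_fin expR_ge0.
  - by apply/measurable_EFinP; exact: has_mean_measurable HG.
  - by move=> w _; have [v vG [_ ->]] := inner w; rewrite lee_fin.
rewrite lee_fin; apply: le_trans (expR_ge1Dx _).
(* The assumption D >= 2 absorbs the exponential moment into the dimension. *)
have D2' : 2 <= D%:R :> R by rewrite ler_nat.
rewrite lerD2l -/c.
have hh : D%:R + v1 <= 2 * D%:R by lra.
by have := ler_wpM2l c0 hh; lra.
Qed.

End measurement_mgf.

(** * Deterministic error bound *)

Section deterministic.
Context {R : realType} (k d m : nat).
Variables (lambda eps delta : R) (a : 'I_m -> 'cV[R]_d) (xi tau : 'I_m -> R).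
Hypotheses (lambda_ge0 : 0 <= lambda).

Let y (g : 'cV[R]_d) i := one_bit (a i) (xi i) (tau i) g.

(** The weight of a measurement whose sign may change when g moves by delta: <a, g> then moves by at
    most delta |a|. *)
Definition flip_weight (delta : R) (a : 'cV[R]_d) (xi tau : R) (g h : 'cV[R]_d) : R :=
  if `|dot a g + xi + tau| <= delta * norm2 a then `|dot a h| else 0.

Lemma one_bit_flip i g g' h : norm2 (g - g') <= delta ->
  `|(y g i - y g' i) * dot (a i) h| <= 2 * flip_weight delta (a i) (xi i) (tau i) g' h.
Proof.
move=> gg; rewrite /flip_weight.
case: (leP `|dot (a i) g' + xi i + tau i| (delta * norm2 (a i))) => H.
  rewrite normrM ler_wpM2r // /y /one_bit /sign.
  by case: ifP => _; case: ifP => _; rewrite ler_norml; lra.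
rewrite mulr0 (_ : y g i = y g' i) ?subrr ?mul0r ?normr0 //.
have : `|dot (a i) (g - g')| < `|dot (a i) g' + xi i + tau i|.
  apply: le_lt_trans H; apply: le_trans (cauchy_schwarz _ _) _.
  by rewrite mulrC ler_wpM2r ?norm2_ge0.
rewrite /y /one_bit /sign dotBr.
set p := dot (a i) g; set q := dot (a i) g'; set r := xi i + tau i.
rewrite -!(addrA _ (xi i)) -/r.
case: (leP 0 (p + r)) => hp; case: (leP 0 (q + r)) => hq // h1.
  by have := le_lt_trans (ler_norm _) h1; rewrite ltr0_norm //; lra.
have := ler_norm (- (p - q)); rewrite normrN => h2.
by have := le_lt_trans h2 h1; rewrite ger0_norm //; lra.
Qed.

(** The second term prices the replacement of [G x0] by its net point. It is a seminorm in h too, so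
    one net in h controls both terms. *)
Let F (g h : 'cV[R]_d) :=
  `|lambda / m%:R * \sum_i y g i * dot (a i) h - dot g h| +
  2 * lambda / m%:R * \sum_i flip_weight delta (a i) (xi i) (tau i) g h.

Let lm_ge0 : 0 <= lambda / m%:R.
Proof. by apply: divr_ge0. Qed.

Let seminorm_F g : seminorm (F g).
Proof.
split=> [u v|c u]; rewrite /F.
  have -> : lambda / m%:R * \sum_i y g i * dot (a i) (u + v) - dot g (u + v) =
      (lambda / m%:R * \sum_i y g i * dot (a i) u - dot g u) +
      (lambda / m%:R * \sum_i y g i * dot (a i) v - dot g v).
    rewrite dotDr; under eq_bigr do rewrite dotDr mulrDr.
    by rewrite big_split /=; ring.
  have h1 : \sum_i flip_weight delta (a i) (xi i) (tau i) g (u + v) <=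
      \sum_i flip_weight delta (a i) (xi i) (tau i) g u +
      \sum_i flip_weight delta (a i) (xi i) (tau i) g v.
    rewrite -big_split; apply: ler_sum => i _; rewrite /flip_weight.
    by case: ifP => _ /=; [rewrite dotDr ler_normD|rewrite addr0].
  have := ler_wpM2l lm_ge0 h1.
  set p := (X in `|X + _|); set q := (X in `|_ + X|); have := ler_normD p q.
  rewrite -mulrA; lra.
have -> : lambda / m%:R * \sum_i y g i * dot (a i) (c *: u) - dot g (c *: u) =
    c * (lambda / m%:R * \sum_i y g i * dot (a i) u - dot g u).
  rewrite dotZr; under eq_bigr do rewrite dotZr mulrCA.
  by rewrite -mulr_sumr; ring.
have -> : \sum_i flip_weight delta (a i) (xi i) (tau i) g (c *: u) =
    `|c| * \sum_i flip_weight delta (a i) (xi i) (tau i) g u.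
  rewrite mulr_sumr; apply: eq_bigr => i _; rewrite /flip_weight.
  by case: ifP => _; rewrite ?mulr0 // dotZr normrM.
by rewrite normrM; ring.
Qed.

(** Minimality gives |h|^2 <= 2 (lambda / m sum_i y_i <a_i, h> - <G x0, h>). Passing to [g] costs
    the flips, already in [F], and delta |h|; with F <= eps |h| / 4 and delta <= eps / 4 the right
    side is at most eps |h|. *)
Lemma minimizer_error (G : 'cV[R]_k -> 'cV[R]_d) (A1 A0 : 'M[R]_(d, k)) x0 xhat g
    (s : seq 'cV[R]_d) :
  G x0 = A0 *m x0 -> G xhat = A1 *m xhat -> norm2 (G x0 - g) <= delta ->
  delta <= eps / 4 ->
  (forall F M, seminorm F -> (forall v, v \in s -> F v <= M) ->
     forall x, F (row_mx A1 A0 *m x) <= 2 * M * norm2 (row_mx A1 A0 *m x)) ->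
  (forall h, h \in s -> F g h <= eps / 8) ->
  is_minimizer (empirical_risk G lambda a (y (G x0))) xhat ->
  norm2 (G xhat - G x0) <= eps.
Proof.
move=> G0 G1 gd de net good /(_ x0); rewrite /empirical_risk.
set h := G xhat - G x0.
have G1E : G xhat = G x0 + h by rewrite subrKC.
have Fh : F g h <= 2 * (eps / 8) * norm2 h.
  (* The difference of two pieces lies in the range of one matrix with 2k columns. *)
  have -> : h = row_mx A1 A0 *m col_mx xhat (- x0).
    by rewrite mul_row_col mulmxN /h G0 G1.
  exact: net (seminorm_F g) good _.
rewrite [in norm2 (G xhat)]G1E norm2_sqrD.
under [in X in X <= _]eq_bigr do rewrite G1E dotDr mulrDr.
rewrite big_split /= => Hmin.
have e1 : \sum_i y (G x0) i * dot (a i) h =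
    \sum_i y g i * dot (a i) h + \sum_i (y (G x0) i - y g i) * dot (a i) h.
  by rewrite -big_split; apply: eq_bigr => i _ /=; ring.
have e2 : \sum_i (y (G x0) i - y g i) * dot (a i) h <=
    2 * \sum_i flip_weight delta (a i) (xi i) (tau i) g h.
  rewrite mulr_sumr; apply: ler_sum => i _; apply: le_trans (ler_norm _) _.
  exact: one_bit_flip.
have e3 := ler_wpM2l lm_ge0 e2.
have e4 : dot g h - dot (G x0) h <= delta * norm2 h.
  rewrite dotC (dotC (G x0)) -dotBr (le_trans (ler_norm _)) //.
  rewrite (le_trans (cauchy_schwarz _ _)) // mulrC ler_wpM2r ?norm2_ge0 //.
  by rewrite -opprB norm2N.
have e5 := ler_wpM2r (norm2_ge0 h) de.
have e6 := ler_norm (lambda / m%:R * \sum_i y g i * dot (a i) h - dot g h).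
have key : norm2 h ^+ 2 <= eps * norm2 h.
  move: Fh Hmin; rewrite /F -/(y _) e1; set S1 := \sum_i y g i * dot (a i) h in e6 *.
  set S2 := \sum_i (y (G x0) i - y g i) * dot (a i) h in e3 *.
  set S3 := \sum_i flip_weight _ _ _ _ _ _ in e3 *.
  rewrite -!(mulrA 2 lambda) in e3 *; move: e3 e4 e5 e6; lra.
have [->|h0] := eqVneq (norm2 h) 0.
  (* For h = 0, eps >= 0 follows from 0 <= |G x0 - g| <= delta <= eps / 4. *)
  have := norm2_ge0 (G x0 - g); lra.
have hp : 0 < norm2 h by rewrite lt0r h0 norm2_ge0.
by rewrite -(ler_pM2r hp) -expr2.
Qed.

End deterministic.

(** * Uniform control over the nets *)

Section union_bound.
Local Open Scope ereal_scope.
Context d (T : measurableType d) (R : realType) (P : probability T R).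

Lemma union_bound (I : eqType) (s : seq I) (B : I -> set T) (p : R) :
  (forall i, i \in s -> measurable (B i)) -> (forall i, i \in s -> P (B i) <= p%:E) ->
  exists2 A, measurable A & P A <= ((size s)%:R * p)%:E /\
    (forall i, i \in s -> B i `<=` A).
Proof.
elim: s => [|i s IH] mB PB.
  by exists set0 => //; rewrite measure0 mul0r; split.
have [|j js|A mA [PA AB]] := IH; first by move=> j js; apply: mB; rewrite inE js orbT.
  by apply: PB; rewrite inE js orbT.
have mBi : measurable (B i) by apply: mB; rewrite mem_head.
exists (B i `|` A); first exact: measurableU.
split.
  apply: le_trans (measureU2 _ mBi mA) _.
  rewrite /= -natr1 mulrDl mul1r addrC EFinD; apply: leeD => //.
  by apply: PB; rewrite mem_head.
by move=> j; rewrite inE => /orP[/eqP ->|/AB jA] x; [left|right; exact: jA].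
Qed.

End union_bound.

(** Both integrals are taken against the common law; moment bounds for the generic triple thus pass
    to each measurement. *)
Lemma same_law_integral d1 d2 d' (T1 : measurableType d1) (T2 : measurableType d2)
    (T' : measurableType d') (R : realType) (P1 : probability T1 R)
    (P2 : probability T2 R) (X : T1 -> T') (Y : T2 -> T') (f : T' -> \bar R) :
  same_law P1 P2 X Y -> measurable_fun setT X -> measurable_fun setT Y ->
  measurable_fun setT f -> (forall z, 0 <= f z)%E ->
  (\int[P1]_w f (X w) = \int[P2]_w f (Y w))%E.
Proof.
move=> XY mX mY mf f0.
pose Xm : {mfun T1 >-> T'} := HB.pack X (isMeasurableFun.Build _ _ _ _ _ mX).
pose Ym : {mfun T2 >-> T'} := HB.pack Y (isMeasurableFun.Build _ _ _ _ _ mY).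
have <- : (\int[distribution P1 Xm]_z f z = \int[P1]_w f (X w))%E.
  by rewrite ge0_integral_distribution.
have <- : (\int[distribution P2 Ym]_z f z = \int[P2]_w f (Y w))%E.
  by rewrite ge0_integral_distribution.
by apply: eq_measure_integral => S mS _; exact: XY.
Qed.

(** * Concentration for the i.i.d. sample *)

Section sample.
Context (R : realType) (D : nat) (lambda : R) (lambda_gt0 : 0 < lambda).
Context d0 (T0 : measurableType d0) (P0 : probability T0 R)
  (a : {RV P0 >-> D.-tuple R}) (xi tau : {RV P0 >-> R}).
Hypotheses (a_mean : mean_zero P0 a) (a_iso : isotropic P0 a).
Hypothesis tau_unif : forall S : set R, measurable S ->
  distribution P0 tau S = uniform_prob (gtrN lambda_gt0) S.
Hypothesis indep : mutually_independent P0
  (tnth [tuple sigma_of a; sigma_of xi; sigma_of tau]).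
Variables (b rho : R) (b_gt0 : 0 < b) (b_le : 4 * b <= lambda).
Hypothesis dot_exp : forall h, norm2 h <= 2 ->
  (\int[P0]_w (expR (`|dot (vec (a w)) h| / b))%:E <= 2%:E)%E.
Hypothesis signal_exp : forall g, norm2 g <= 2 * rho ->
  (\int[P0]_w (expR (`|dot (vec (a w)) g + xi w| / b))%:E <= 2%:E)%E.
Hypothesis rho_ge0 : 0 <= rho.
Variable eps : R.
Hypotheses (eps_gt0 : 0 < eps) (eps_lt1 : eps < 1) (lambda_ge1 : 1 <= lambda).
Hypothesis tail_le : b ^+ 2 * expR (- (lambda / (2 * b))) <= (eps / 512) ^+ 2.
Hypothesis D_ge2 : (2 <= D)%N.

Context (m : nat) (m_gt0 : (0 < m)%N) d1 (T : measurableType d1) (P : probability T R)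
  (as_ : 'I_m -> {RV P >-> D.-tuple R}) (xis taus : 'I_m -> {RV P >-> R}).
Hypothesis copies : forall i,
  same_law P P0 (triple (as_ i) (xis i) (taus i)) (triple a xi tau).
Hypothesis sample_indep : mutually_independent P
  (fun i => sigma_of (triple (as_ i) (xis i) (taus i))).

Let mtriple i : measurable_fun setT (triple (as_ i) (xis i) (taus i)).
Proof. by apply: measurable_fun_pair => //; exact: measurable_fun_pair. Qed.

Let mtriple0 : measurable_fun setT (triple a xi tau).
Proof. by apply: measurable_fun_pair => //; exact: measurable_fun_pair. Qed.

Lemma sample_chernoff (phi : D.-tuple R * R * R -> R) (c t : R) :
  measurable_fun setT phi ->
  (\int[P0]_w (expR (phi (a w, xi w, tau w)))%:E <= (expR c)%:E)%E ->
  (P [set w | (t <= \sum_i phi (as_ i w, xis i w, taus i w))%R] <=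
   (expR (m%:R * c - t))%:E)%E.
Proof.
move=> mphi Hc.
have mexp : measurable_fun setT (fun z => (expR (phi z))%:E).
  by apply/measurable_EFinP; exact: measurableT_comp.
have := @chernoff_indep _ _ _ P _ _ _ (fun i => triple (as_ i) (xis i) (taus i))
  mtriple sample_indep phi c t mphi.
rewrite card_ord; apply => i.
rewrite (same_law_integral (copies i) (mtriple i) mtriple0 mexp) //.
Qed.

Let mvec : measurable_fun setT (fun q : D.-tuple R * R * R => q.1.1).
Proof. by apply: measurableT_comp => //; exact: measurable_fst. Qed.

Let msum (g : 'cV[R]_D) :
  measurable_fun setT (fun q : D.-tuple R * R * R => dot (vec q.1.1) g + q.1.2 + q.2).
Proof.
apply: measurable_funD => //; apply: measurable_funD; first exact: measurable_dot.
by apply: measurableT_comp => //; exact: measurable_fst.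
Qed.

Definition deviation (w : T) (g h : 'cV[R]_D) : R :=
  lambda / m%:R * (\sum_i one_bit (vec (as_ i w)) (xis i w) (taus i w) g *
     dot (vec (as_ i w)) h) - dot g h.

Definition flips delta (w : T) (g h : 'cV[R]_D) : R :=
  \sum_i flip_weight delta (vec (as_ i w)) (xis i w) (taus i w) g h.

(** Chernoff's bound at level 0, since the margin eps / 16 is already subtracted inside [phi]. *)
Lemma deviation_bound g h : norm2 g <= 2 * rho -> norm2 h <= 2 ->
  exists2 A, measurable A &
    (P A <= (expR (- (m%:R * ((eps / lambda) ^+ 2 / (512 * 256)))))%:E)%E /\
    forall w, ~ A w -> deviation w g h <= eps / 16.
Proof.
move=> g2 h2; set s := eps / (32 * 32 * lambda ^+ 2).
pose phi (q : D.-tuple R * R * R) :=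
  s * (lambda * one_bit (vec q.1.1) q.1.2 q.2 g * dot (vec q.1.1) h - dot g h - eps / 16).
have mphi : measurable_fun setT phi.
  apply: measurable_funM => //; apply: measurable_funB => //; apply: measurable_funB => //.
  apply: measurable_funM; last exact: measurable_dot.
  by apply: measurable_funM => //; apply: measurable_sign; exact: msum.
have s0 : 0 < s.
  by rewrite divr_gt0 // mulr_gt0 // ?mulr_gt0 // exprn_gt0.
exists [set w | 0 <= \sum_i phi (as_ i w, xis i w, taus i w)].
  rewrite -[X in measurable X]setTI; apply: measurable_fun_ler => //.
  by apply: measurable_sum => i; exact: (measurableT_comp mphi (mtriple i)).
split.
  have := @sample_chernoff phi _ 0 mphi (mgf_one_bit a_mean a_iso tau_unif indep b_gt0 b_le
     dot_exp signal_exp rho_ge0 eps_gt0 eps_lt1 lambda_ge1 tail_le g2 h2).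
  by rewrite subr0 mulrN.
move=> w /= /negP; rewrite -ltNge /phi -mulr_sumr pmulr_rlt0 //.
rewrite /= !sumrB !sumr_const card_ord -[dot g h *+ m]mulr_natl -[(eps / 16) *+ m]mulr_natl.
have mp : 0 < m%:R :> R by rewrite ltr0n.
have -> : \sum_i lambda * one_bit (vec (as_ i w)) (xis i w) (taus i w) g * dot (vec (as_ i w)) h =
    lambda * \sum_i one_bit (vec (as_ i w)) (xis i w) (taus i w) g * dot (vec (as_ i w)) h.
  by rewrite mulr_sumr; apply: eq_bigr => i _; rewrite mulrA.
rewrite /deviation; set S := \sum_i _ => H.
rewrite -(ler_pM2l mp) mulrBr mulrA [m%:R * _]mulrC divfK ?gt_eqF //; lra.
Qed.

(** The small mesh keeps the total log-moment below 1, so the level 1 + L is exceeded with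
    probability at most exp(-L). *)
Lemma flips_bound delta L g h : norm2 h <= 2 -> 0 <= delta ->
  m%:R * (delta / lambda * D%:R) <= 1 ->
  exists2 A, measurable A & (P A <= (expR (- L))%:E)%E /\
    forall w, ~ A w -> flips delta w g h <= 2 * b * (1 + L).
Proof.
move=> h2 de0 dle.
have b20 : 0 < 2 * b by rewrite mulr_gt0.
pose phi (q : D.-tuple R * R * R) :=
  (2 * b)^-1 * flip_weight delta (vec q.1.1) q.1.2 q.2 g h.
have mphi : measurable_fun setT phi.
  apply: measurable_funM => //; apply: measurable_fun_ifT => //; last first.
    by apply: measurableT_comp => //; exact: measurable_dot.
  apply: measurable_fun_ler; last by apply: measurable_funM => //; exact: measurable_norm2.
  by apply: measurableT_comp => //; exact: msum.
exists [set w | 1 + L <= \sum_i phi (as_ i w, xis i w, taus i w)].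
  rewrite -[X in measurable X]setTI; apply: measurable_fun_ler => //.
  by apply: measurable_sum => i; exact: (measurableT_comp mphi (mtriple i)).
split.
  have H := @sample_chernoff phi _ (1 + L) mphi
    (mgf_flip a_iso tau_unif indep b_gt0 dot_exp g D_ge2 h2 de0).
  by apply: le_trans H _; rewrite lee_fin ler_expR; lra.
move=> w /= /negP; rewrite -ltNge /phi -mulr_sumr /= => /ltW H.
by rewrite mulrC -ler_pdivrMr // mulrC.
Qed.

(** Three bad events per pair, hence the factor 3: the deviation at h, the deviation at -h, which
    gives the absolute value, and the flips. *)
Lemma net_bound delta L (s : seq ('cV[R]_D * 'cV[R]_D)) :
  (forall p, p \in s -> norm2 p.1 <= 2 * rho /\ norm2 p.2 <= 2) -> 0 <= delta ->
  m%:R * (delta / lambda * D%:R) <= 1 ->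
  L <= m%:R * ((eps / lambda) ^+ 2 / (512 * 256)) ->
  exists2 A, measurable A & (P A <= ((size s)%:R * (3 * expR (- L)))%:E)%E /\
    forall w, ~ A w -> forall p, p \in s ->
      `|deviation w p.1 p.2| <= eps / 16 /\ flips delta w p.1 p.2 <= 2 * b * (1 + L).
Proof.
move=> sP de0 dle Lle.
have ex p : exists A, p \in s -> [/\ measurable A, (P A <= (3 * expR (- L))%:E)%E &
    forall w, ~ A w -> `|deviation w p.1 p.2| <= eps / 16 /\
      flips delta w p.1 p.2 <= 2 * b * (1 + L)].
  (* The empty set is a default off the list, which lets [choice] produce a total function. *)
  have [ps|_] := boolP (p \in s); last by exists set0.
  have [g2 h2] := sP _ ps.
  have hN2 : norm2 (- p.2) <= 2 by rewrite norm2N.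
  have [A1 mA1 [PA1 H1]] := deviation_bound g2 h2.
  have [A2 mA2 [PA2 H2]] := deviation_bound g2 hN2.
  have [A3 mA3 [PA3 H3]] := flips_bound L p.1 h2 de0 dle.
  exists (A1 `|` A2 `|` A3) => _; split.
  - by apply: measurableU => //; exact: measurableU.
  - have eL : expR (- (m%:R * ((eps / lambda) ^+ 2 / (512 * 256)))) <= expR (- L).
      by rewrite ler_expR lerN2.
    have mA12 : measurable (A1 `|` A2) by exact: measurableU.
    apply: le_trans (measureU2 _ mA12 mA3) _.
    have -> : 3 * expR (- L) = (expR (- L) + expR (- L)) + expR (- L) by ring.
    rewrite !EFinD leeD // (le_trans (measureU2 _ mA1 mA2)) // leeD //.
      by rewrite (le_trans PA1) // lee_fin.
    by rewrite (le_trans PA2) // lee_fin.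
  - move=> w nA; split; last by apply: H3 => ?; apply: nA; right.
    have h1 : deviation w p.1 p.2 <= eps / 16 by apply: H1 => ?; apply: nA; left; left.
    have : deviation w p.1 (- p.2) <= eps / 16 by apply: H2 => ?; apply: nA; left; right.
    have -> : deviation w p.1 (- p.2) = - deviation w p.1 p.2.
      rewrite /deviation -scaleN1r dotZr; under eq_bigr do rewrite dotZr mulrCA.
      by rewrite -mulr_sumr; ring.
    by rewrite ler_norml h1 andbT; lra.
have [B HB] := choice ex.
have [|p ps|A mA [PA AB]] := @union_bound _ _ _ P _ s B (3 * expR (- L)).
- by move=> p /HB[].
- by have [] := HB _ ps.
exists A => //; split => // w nA p ps; have [_ _] := HB _ ps; apply.
by move=> /(AB _ ps).
Qed.

End sample.

(** * Counting and constants *)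

Section nets.
Context {R : realType}.

Lemma size_flatten_map_le (I J : Type) (M : R) (f : I -> seq J) (s : seq I) :
  (forall i, (size (f i))%:R <= M) ->
  (size (flatten [seq f i | i <- s]))%:R <= (size s)%:R * M.
Proof.
move=> fM; elim: s => [|i s IH] /=; first by rewrite mul0r.
by rewrite size_cat natrD -natr1 mulrDl mul1r addrC lerD.
Qed.

(** One cell for each pair of pieces, [A1] for [xhat] and [A0] for [x0]: g runs over a net of the
    range of [A0], h over a net for the joint range. The four factors of the count are two choices
    of piece and two nets. *)
Lemma network_nets (w : nat -> nat) (W : forall i, 'M[R]_(w i.+1, w i)) n (rho delta : R) :
  (forall i, (1 <= i <= n)%N -> (w i <= w n)%N) -> (0 < w n)%N -> 1 <= rho ->
  0 < delta -> delta <= 1 ->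
  exists s : seq ('cV[R]_(w n) * 'cV[R]_(w n)),
  [/\ (size s)%:R <= ((w n).+1%:R ^+ (w 0%N * n)) ^+ 2 *
        ((2 * rho * (w n)%:R / delta + 1) ^+ w 0%N * (4 * (w n)%:R + 1) ^+ (w 0%N + w 0%N)),
      forall p, p \in s -> norm2 p.1 <= 2 * rho /\ norm2 p.2 <= 2 &
      forall x0 xhat, norm2 (relu_net W n x0) <= rho ->
        exists A1 A0 g (s' : seq 'cV[R]_(w n)),
        [/\ relu_net W n x0 = A0 *m x0, relu_net W n xhat = A1 *m xhat,
            norm2 (relu_net W n x0 - g) <= delta,
            (forall F M, seminorm F -> (forall v, v \in s' -> F v <= M) ->
              forall x, F (row_mx A1 A0 *m x) <= 2 * M * norm2 (row_mx A1 A0 *m x)) &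
            forall h, h \in s' -> (g, h) \in s]].
Proof.
move=> wD d0 rho1 de0 de1; have rho0 : 0 <= rho by apply: le_trans rho1.
have [As [szA AsP]] := relu_net_pieces W wD.
have gnet (A : 'M[R]_(w n, w 0%N)) := cid (range_net A d0 de0 rho0).
have hnet (A : 'M[R]_(w n, w 0%N + w 0%N)) := cid (seminorm_net A d0).
pose gs A := [seq g <- sval (gnet A) | norm2 g <= 2 * rho].
pose hs A1 A0 := sval (hnet (row_mx A1 A0)).
pose cell A1 A0 := [seq (g, h) | g <- gs A0, h <- hs A1 A0].
exists (flatten [seq flatten [seq cell A1 A0 | A0 <- As] | A1 <- As]); split.
- set Mg := (_ + 1) ^+ w 0%N; set Mh := (_ + 1) ^+ (_ + _).
  have szAR : (size As)%:R <= (w n).+1%:R ^+ (w 0%N * n) :> R by rewrite -natrX ler_nat.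
  have cellM A1 A0 : (size (cell A1 A0))%:R <= Mg * Mh.
    rewrite size_allpairs natrM ler_pM //.
      have [+ _] := svalP (gnet A0); apply: le_trans.
      by rewrite ler_nat size_filter count_size.
    by have [] := svalP (hnet (row_mx A1 A0)).
  have M0 : 0 <= Mg * Mh by apply: le_trans (cellM 0 0).
  apply: le_trans (size_flatten_map_le (M := (size As)%:R * (Mg * Mh)) _ _) _.
    by move=> A1; exact: size_flatten_map_le.
  rewrite mulrA ler_wpM2r // expr2 ler_pM //.
- move=> p /flatten_mapP[A1 _ /flatten_mapP[A0 _ /allpairsP[[g h] /= [gg hh ->]]]] /=.
  split; first by move: gg; rewrite mem_filter => /andP[].
  by have [_ + _] := svalP (hnet (row_mx A1 A0)); apply.
move=> x0 xhat x0rho; have [A0 A0s G0] := AsP x0; have [A1 A1s G1] := AsP xhat.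
have [g gs0 gd] : exists2 g, g \in sval (gnet A0) & norm2 (relu_net W n x0 - g) <= delta.
  rewrite G0; have [_] := svalP (gnet A0); apply.
  by rewrite -G0.
exists A1, A0, g, (hs A1 A0); split => //.
  by have [_ _] := svalP (hnet (row_mx A1 A0)).
move=> h hh; apply/flatten_mapP; exists A1 => //; apply/flatten_mapP; exists A0 => //.
apply: allpairs_f => //; rewrite mem_filter gs0 andbT.
(* The net point has norm at most rho + delta <= 2 rho, so the filter keeps it. *)
have -> : g = relu_net W n x0 - (relu_net W n x0 - g) by rewrite opprB subrKC.
apply: le_trans (norm2D _ _) _; rewrite norm2N; move: x0rho gd; lra.
Qed.

(** The bracket of the sample-size condition: all but [u] pays for the nets, [u] for the
    confidence. *)
Definition complexity (k n d m : nat) (rho u : R) : R :=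
  k%:R * n%:R * ln (expR 1 * d%:R) + k%:R * ln (2 * rho) + k%:R * ln m%:R + u.

Lemma complexity_ge1 (k n d m : nat) (rho u : R) : (0 < k)%N -> (0 < n)%N ->
  (0 < d)%N -> (0 < m)%N -> 1 <= rho -> 0 <= u -> 1 <= complexity k n d m rho u.
Proof.
rewrite /complexity -!(ler1n R) => k0 n0 d0 m0 rho1 u0.
have Ld1 : 1 <= ln (expR 1 * d%:R) :> R.
  have dp : 0 < d%:R :> R by apply: lt_le_trans d0.
  by rewrite lnM ?posrE ?expR_gt0 // expRK lerDl ln_ge0.
have h1 : 1 <= k%:R * n%:R :> R by have := ler_pM ler01 ler01 k0 n0; rewrite mulr1.
have h2 := ler_pM ler01 ler01 h1 Ld1; rewrite mulr1 in h2.
have h3 : 0 <= k%:R * ln (2 * rho) by apply: mulr_ge0 => //; apply: ln_ge0; lra.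
have h4 : 0 <= k%:R * ln m%:R :> R by apply: mulr_ge0 => //; exact: ln_ge0.
lra.
Qed.

(** The mesh is 1 / (m d). By d+1 <= e d and 4d+1 <= (e d)^2, the pieces, the g-net and the h-net
    contribute 2kn, 2k and 4k times log(e d); n >= 1 turns the sum into at most 8kn. *)
Lemma net_count (k n d m : nat) (rho u : R) : (0 < n)%N -> (2 <= d)%N -> (0 < m)%N -> 1 <= rho ->
  (d.+1%:R ^+ (k * n)) ^+ 2 *
    ((2 * rho * d%:R / (m%:R * d%:R)^-1 + 1) ^+ k * (4 * d%:R + 1) ^+ (k + k)) <=
  expR (8 * (complexity k n d m rho u - u)).
Proof.
rewrite /complexity addrK => n0 d2 m0 rho1.
have e2 : 2 <= expR 1 :> R by have := expR_ge1Dx (1 : R); lra.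
have d2R : 2 <= d%:R :> R by rewrite ler_nat.
have m1R : 1 <= m%:R :> R by rewrite ler1n.
have n1R : 1 <= n%:R :> R by rewrite ler1n.
have ed : 2 * d%:R <= expR 1 * d%:R :> R by rewrite ler_wpM2r.
have edp : 0 < expR 1 * d%:R :> R by rewrite mulr_gt0 ?expR_gt0 //; lra.
set Ld := ln (expR 1 * d%:R); have eLd : expR Ld = expR 1 * d%:R by rewrite lnK ?posrE.
have Ld0 : 0 <= Ld by rewrite ln_ge0 //; lra.
have r2 : 0 < 2 * rho by lra.
set Lr := ln (2 * rho); have eLr : expR Lr = 2 * rho by rewrite lnK ?posrE.
have mp : 0 < m%:R :> R by rewrite ltr0n.
set Lm := ln m%:R; have eLm : expR Lm = m%:R :> R by rewrite lnK ?posrE.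
have Lr0 : 0 <= Lr by rewrite ln_ge0 //; lra.
have Lm0 : 0 <= Lm by rewrite ln_ge0.
have b1 : d.+1%:R <= expR Ld by rewrite eLd -natr1; lra.
have sq4 : 4 * (d%:R * d%:R) <= expR Ld * expR Ld.
  by rewrite eLd; have := ler_pM (ltac:(lra) : 0 <= 2 * d%:R :> R) (ltac:(lra) : 0 <= 2 * d%:R :> R) ed ed; lra.
have dd : 2 * d%:R <= d%:R * d%:R :> R by rewrite ler_wpM2r.
have e2L : expR (2 * Ld) = expR Ld * expR Ld by rewrite -expRD; congr expR; ring.
have b3 : 4 * d%:R + 1 <= expR (2 * Ld) by rewrite e2L; lra.
have b2 : 2 * rho * d%:R / (m%:R * d%:R)^-1 + 1 <= expR (Lr + Lm + 2 * Ld).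
  rewrite invrK !expRD eLr eLm e2L.
  have rm : 2 <= 2 * rho * m%:R by have := ler_pM ler01 ler01 rho1 m1R; lra.
  have q : 2 * rho * m%:R * (4 * (d%:R * d%:R)) <= 2 * rho * m%:R * (expR Ld * expR Ld).
    by rewrite ler_wpM2l //; lra.
  have : 2 * (2 * d%:R) <= 2 * rho * m%:R * (d%:R * d%:R) by apply: ler_pM => //; lra.
  lra.
have p1 : (d.+1%:R ^+ (k * n)) ^+ 2 <= expR (2 * ((k * n)%:R * Ld)).
  by rewrite expRM_natl expRM_natl !lerXn2r ?nnegrE ?exprn_ge0 ?expR_ge0.
have p2 : (2 * rho * d%:R / (m%:R * d%:R)^-1 + 1) ^+ k <= expR (k%:R * (Lr + Lm + 2 * Ld)).
  rewrite expRM_natl lerXn2r ?nnegrE ?expR_ge0 // invrK.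
  by rewrite addr_ge0 // !mulr_ge0 //; lra.
have p3 : (4 * d%:R + 1) ^+ (k + k) <= expR ((k + k)%:R * (2 * Ld)).
  by rewrite expRM_natl lerXn2r ?nnegrE ?expR_ge0 //; lra.
apply: le_trans (_ : expR (2 * ((k * n)%:R * Ld)) *
  (expR (k%:R * (Lr + Lm + 2 * Ld)) * expR ((k + k)%:R * (2 * Ld))) <= _).
  have q1 : 0 <= 2 * rho * d%:R / (m%:R * d%:R)^-1 + 1.
    by rewrite invrK addr_ge0 // !mulr_ge0 //; lra.
  have q2 : 0 <= 4 * d%:R + 1 :> R by lra.
  exact: (ler_pM (exprn_ge0 2 (exprn_ge0 _ (ler0n _ _)))
    (mulr_ge0 (exprn_ge0 _ q1) (exprn_ge0 _ q2)) p1
    (ler_pM (exprn_ge0 _ q1) (exprn_ge0 _ q2) p2 p3)).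
rewrite -!expRD ler_expR natrM natrD.
have k0 : 0 <= k%:R :> R by rewrite ler0n.
have kL : 0 <= k%:R * Ld by rewrite mulr_ge0.
have kLr : 0 <= k%:R * Lr by rewrite mulr_ge0.
have kLm : 0 <= k%:R * Lm by rewrite mulr_ge0.
have : k%:R * Ld * 1 <= k%:R * Ld * n%:R by rewrite ler_wpM2l.
lra.
Qed.

Lemma effective_sample_size (c lambda m Bk eps : R) : 0 <= c -> 4 <= lambda -> 1 <= m ->
  0 < eps -> 1 <= Bk ->
  c * lambda ^+ 2 * ln (lambda * m) ^+ 2 * Bk / eps ^+ 2 <= m ->
  c * lambda ^+ 2 * Bk <= m * eps ^+ 2.
Proof.
move=> c0 l4 m1 e0 B1; rewrite ler_pdivrMr ?exprn_gt0 //; apply: le_trans.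
have lm4 : 4 <= lambda * m.
  by have := ler_pM (ler0n R 4) ler01 l4 m1; rewrite mulr1.
have lm1 : 1 <= ln (lambda * m).
  by rewrite -ler_expR lnK ?posrE; [apply: le_trans expR1_le4 _|lra].
have lm2 : 1 <= ln (lambda * m) ^+ 2 by rewrite expr_ge1 //; lra.
apply: ler_wpM2r; first by lra.
have c2 : 0 <= c * lambda ^+ 2 by apply: mulr_ge0 => //; exact: sqr_ge0.
by have := ler_wpM2l c2 lm2; rewrite mulr1.
Qed.

(** In order: the mesh against the accuracy, the log-moment of the flips, L = 8 Bk against the
    Chernoff exponent, and the flip term of the seminorm. The third fixes the constant 1024 * 1024 =
    8 * 512 * 256. *)
Lemma sample_size_budget (lambda eps b m d Bk : R) : 0 < eps -> eps < 1 -> 0 < b ->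
  4 * b <= lambda -> 1 <= lambda -> 1 <= Bk -> 0 < m -> 1 <= d ->
  1024 * 1024 * lambda ^+ 2 * Bk <= m * eps ^+ 2 ->
  [/\ (m * d)^-1 <= eps / 4, m * ((m * d)^-1 / lambda * d) <= 1,
      8 * Bk <= m * ((eps / lambda) ^+ 2 / (512 * 256)) &
      2 * lambda / m * (2 * b * (1 + 8 * Bk)) <= eps / 16].
Proof.
move=> e0 e1 b0 bl l1 B1 m0 d1 Hm.
have l0 : 0 < lambda by lra.
have d0 : 0 < d by lra.
have l2 : 1 <= lambda ^+ 2 by rewrite expr_ge1 //; lra.
have lB : 1 <= lambda ^+ 2 * Bk by have := ler_pM ler01 ler01 l2 B1; lra.
have me : m * eps ^+ 2 <= m * eps.
  by rewrite expr2 mulrA; have := ler_wpM2l (ltac:(apply: mulr_ge0; lra) : 0 <= m * eps) (ltW e1); lra.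
have me4 : 4 <= m * eps by lra.
have md0 : 0 < m * d by rewrite mulr_gt0.
split.
- rewrite -[leLHS]mul1r ler_pdivrMr //.
  have : 4 * 1 <= m * eps * d by apply: ler_pM => //; lra.
  lra.
- have -> : m * ((m * d)^-1 / lambda * d) = lambda^-1 by field; rewrite !gt_eqF.
  by rewrite invf_le1.
- rewrite expr_div_n mulrA ler_pdivlMr; last by lra.
  rewrite [leRHS]mulrA ler_pdivlMr; last by lra.
  move: Hm; lra.
rewrite mulrAC ler_pdivrMr //.
have h1 : 4 * b * lambda <= lambda ^+ 2 by rewrite expr2 ler_wpM2r // ltW.
have h2 : 4 * b * lambda * (1 + 8 * Bk) <= lambda ^+ 2 * (9 * Bk).
  by apply: ler_pM => //; [apply: mulr_ge0; lra|lra|lra].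
move: Hm me h2; lra.
Qed.

(** With l the logarithm and b = C / 4, the exponent lambda / (2 b) is at least 4 l, and exp(-4 l) =
    (eps / (64 C))^4 beats the required square. *)
Lemma tail_budget (C eps lambda : R) : 1 <= C -> 0 < eps -> eps < 1 ->
  4 * C * ln (64 * C * eps^-1) <= lambda ->
  [/\ C <= lambda, 4 <= lambda &
    (C / 4) ^+ 2 * expR (- (lambda / (2 * (C / 4)))) <= (eps / 512) ^+ 2].
Proof.
move=> C1 e0 e1 Hl.
have C0 : 0 < C by lra.
have e41 : expR 1 <= 4 :> R := expR1_le4.
have ei : 1 <= eps^-1 by rewrite invf_ge1 // ltW.
have x64 : 64 <= 64 * C * eps^-1.
  by have := ler_pM ler01 ler01 C1 ei; lra.
have xp : 0 < 64 * C * eps^-1 by lra.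
set l := ln (64 * C * eps^-1).
have el : expR l = 64 * C * eps^-1 by rewrite lnK ?posrE.
have l1 : 1 <= l by rewrite -ler_expR el; lra.
have Cl : C <= C * l by rewrite ler_peMr // ltW.
have lamC : 4 * C <= lambda by rewrite -/l in Hl; lra.
split; [lra|lra|].
have h : expR (- (lambda / (2 * (C / 4)))) <= expR (- (4%:R * l)).
  rewrite ler_expR lerN2 ler_pdivlMr; last by lra.
  by rewrite -/l in Hl; have : 0 <= C * l by [lra]; lra.
have r : expR (- l) = eps / (64 * C) by rewrite expRN el invfM invrK mulrC.
have -> : (eps / 512) ^+ 2 = (C / 4) ^+ 2 * (eps / (128 * C)) ^+ 2.
  by field; rewrite gt_eqF.
rewrite ler_wpM2l ?sqr_ge0 // (le_trans h) // -mulrN expRM_natl r.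
have x0 : 0 <= eps / (64 * C) by apply: divr_ge0; lra.
have x64' : eps / (64 * C) <= 64^-1 by rewrite -r expRN el lef_pV2 ?posrE.
have -> : (eps / (128 * C)) ^+ 2 = (eps / (64 * C)) ^+ 2 * 4^-1 by field; rewrite gt_eqF.
move: x0 x64'; set x := eps / (64 * C) => x0 x64'.
have -> : x ^+ 4 = x ^+ 2 * x ^+ 2 by ring.
rewrite ler_wpM2l ?sqr_ge0 // expr2.
have := ler_pM x0 x0 x64' x64'; lra.
Qed.

End nets.

(** * From psi_1 norms to exponential moments *)

Section orlicz.
Context d (T : measurableType d) (R : realType) (P : probability T R).

Lemma psi1_norm_ge0 (X : T -> R) : (0 <= psi1_norm P X)%E.
Proof.
apply: le_trans (_ : ((1^-1)%:E * 'N[P]_(1%:E)[EFin \o X] <= _)%E).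
  by rewrite mule_ge0 // ?lee_fin ?invr_ge0 // Lnorm_ge0.
by apply: ereal_sup_ubound; exists 1 => //=.
Qed.

Lemma psi1_norm_le_vec D (a : T -> D.-tuple R) (t : 'cV[R]_D) : norm2 t = 1 ->
  (psi1_norm P (fun w => dot (vec (a w)) t) <= psi1_norm_vec P a)%E.
Proof. by move=> t1; apply: ereal_sup_ubound; exists t. Qed.

(** A unit vector exists in positive dimension; over an empty sphere the supremum would be -oo. *)
Lemma psi1_norm_vec_ge0 D (a : T -> D.-tuple R) : (0 < D)%N -> (0 <= psi1_norm_vec P a)%E.
Proof.
case: D a => // D a _; pose t : 'cV[R]_D.+1 := delta_mx 0 0.
have t1 : norm2 t = 1.
  rewrite /norm2 /dot (bigD1 0) //= !mxE eqxx mulr1 big1 ?addr0 ?sqrtr1 //.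
  by move=> i i0; rewrite !mxE (negbTE i0) mul0r.
exact: le_trans (psi1_norm_ge0 _) (psi1_norm_le_vec a t1).
Qed.

(** Homogeneity reduces to the unit vector h / |h|; h = 0 has no direction and is treated apart. *)
Lemma vec_expR D (a : {RV P >-> D.-tuple R}) (K r : R) (h : 'cV[R]_D) :
  (psi1_norm_vec P a <= K%:E)%E -> 0 < K -> 0 < r -> norm2 h <= r ->
  (\int[P]_w (expR (`|dot (vec (a w)) h| / (8 * r * K)))%:E <= 2%:E)%E.
Proof.
move=> aK K0 r0 hr.
have [/norm2_eq0 ->|h0] := eqVneq (norm2 h) 0.
  have -> : (\int[P]_w (expR (`|dot (vec (a w)) 0| / (8 * r * K)))%:E =
      \int[P]_w (cst 1%:E w))%E.
    apply: eq_integral => w _.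
    by rewrite -(scale0r (0 : 'cV_D)) dotZr mul0r normr0 mul0r expR0.
  rewrite integral_cst //= mul1e (le_trans (probability_le1 P measurableT)) //.
  by rewrite lee_fin; lra.
have hp : 0 < norm2 h by rewrite lt0r h0 norm2_ge0.
pose t := (norm2 h)^-1 *: h.
have t1 : norm2 t = 1 by rewrite norm2Z ger0_norm ?invr_ge0 ?norm2_ge0 // mulVf.
have hE : h = norm2 h *: t by rewrite scalerA divff // scale1r.
have mt v : measurable_fun setT (fun w => dot (vec (a w)) v) by exact: measurable_dot.
have me v c : measurable_fun setT (fun w => (expR (`|dot (vec (a w)) v| / c))%:E).
  apply/measurable_EFinP; apply: measurableT_comp => //; apply: measurable_funM => //.
  by apply: measurableT_comp => //; exact: mt.
apply: le_trans (psi1_expR (mt t) (le_trans (psi1_norm_le_vec a t1) aK) K0).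
apply: ge0_le_integral => //; try exact: me.
move=> w _; rewrite lee_fin ler_expR {1}hE dotZr normrM (ger0_norm (norm2_ge0 h)).
have K8 : 0 < 8 * K by lra.
have -> : 8 * r * K = r * (8 * K) by ring.
rewrite invfM mulrA ler_wpM2r ?invr_ge0 ?(ltW K8) //.
by rewrite ler_pdivrMr // mulrC ler_wpM2l.
Qed.

(** Doubling the scale makes each factor a square root, and AM-GM averages the two moments. The
    noise bound is relaxed to 2 Q so that both have scale 16 Q. *)
Lemma signal_expR D (a : {RV P >-> D.-tuple R}) (xi : {RV P >-> R}) (rho Q : R) (g : 'cV[R]_D) :
  (psi1_norm_vec P a <= (Q / rho)%:E)%E -> (psi1_norm P xi <= Q%:E)%E -> 0 < Q -> 0 < rho ->
  norm2 g <= 2 * rho ->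
  (\int[P]_w (expR (`|dot (vec (a w)) g + xi w| / (32 * Q)))%:E <= 2%:E)%E.
Proof.
move=> aQ xQ Q0 rho0 gr.
have r20 : 0 < 2 * rho by lra.
have mg : measurable_fun setT (fun w => dot (vec (a w)) g) by exact: measurable_dot.
have me (f : T -> R) c : measurable_fun setT f ->
    measurable_fun setT (fun w => expR (`|f w| / c)).
  move=> mf; apply: measurableT_comp => //; apply: measurable_funM => //.
  exact: measurableT_comp.
have Qr0 : 0 < Q / rho by rewrite divr_gt0.
have [v1 v1le H1] := has_mean_le (me _ _ mg) (fun w => expR_ge0 _) (vec_expR aQ Qr0 r20 gr).
have Q20 : 0 < 2 * Q by lra.
have xQ2 : (psi1_norm P xi <= (2 * Q)%:E)%E by apply: le_trans xQ _; rewrite lee_fin; lra.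
have mxi : measurable_fun setT xi by [].
have [v2 v2le H2] := has_mean_le (me _ _ mxi) (fun w => expR_ge0 _) (psi1_expR mxi xQ2 Q20).
have H := has_meanZ 2^-1 (has_meanD H1 H2).
apply: le_trans (le_has_mean _ _ _ H) _.
- by apply: me; exact: measurable_funD.
- by move=> w; exact: expR_ge0.
- move=> w; set x := dot _ _; set y := xi w.
  have -> : 8 * (2 * rho) * (Q / rho) = 16 * Q by field; rewrite gt_eqF.
  have -> : 8 * (2 * Q) = 16 * Q by ring.
  pose p := expR (`|x| / (32 * Q)); pose q := expR (`|y| / (32 * Q)).
  have pE : expR (`|x| / (16 * Q)) = p ^+ 2.
    by rewrite -expRM_natl; congr expR; field; rewrite gt_eqF.
  have qE : expR (`|y| / (16 * Q)) = q ^+ 2.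
    by rewrite -expRM_natl; congr expR; field; rewrite gt_eqF.
  have : expR (`|x + y| / (32 * Q)) <= p * q.
    rewrite -expRD ler_expR -mulrDl ler_wpM2r ?ler_normD //.
    by rewrite invr_ge0; lra.
  by rewrite pE qE; have := sqr_ge0 (p - q); rewrite sqrrB; lra.
by rewrite lee_fin; lra.
Qed.

Lemma moment_budget D (a : {RV P >-> D.-tuple R}) (xi : {RV P >-> R})
    (C K Kx rho lambda : R) :
  1 <= C -> 128 * (rho * K + Kx) <= C -> 1 <= rho -> 0 <= K -> 0 <= Kx ->
  psi1_norm_vec P a = K%:E -> psi1_norm P xi = Kx%:E -> C <= lambda -> 4 <= lambda ->
  [/\ 0 < C / 4, 4 * (C / 4) <= lambda, 1 <= lambda,
      forall h, norm2 h <= 2 ->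
        (\int[P]_w (expR (`|dot (vec (a w)) h| / (C / 4)))%:E <= 2%:E)%E &
      forall g, norm2 g <= 2 * rho ->
        (\int[P]_w (expR (`|dot (vec (a w)) g + xi w| / (C / 4)))%:E <= 2%:E)%E].
Proof.
move=> C1 CK rho1 K0 Kx0 KE KxE Cl l4.
have rho0 : 0 < rho by lra.
have rK : 0 <= rho * K by rewrite mulr_ge0 // ltW.
have KrK : K <= rho * K by rewrite ler_peMl.
(* The constant 128 makes rho K and Kx at most Q, and the scale 32 Q of [signal_expR] is then C /
   4. *)
pose Q := C / 128; have Q0 : 0 < Q by rewrite /Q; lra.
have -> : C / 4 = 32 * Q by rewrite /Q; field.
split; [lra|rewrite /Q; lra|lra|move=> h h2|move=> g].
  have -> : 32 * Q = 8 * 2 * (2 * Q) by ring.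
  by apply: vec_expR h2; [rewrite KE lee_fin /Q; lra|lra|lra].
apply: signal_expR => //; first by rewrite KE lee_fin ler_pdivlMr // /Q; lra.
by rewrite KxE lee_fin /Q; lra.
Qed.

End orlicz.

(** * Assembly of the nets, the concentration bounds and the deterministic error bound *)

Theorem theorem3p2 (R : realType) :
  exists c1 c2 c3 : R, [/\ 1 <= c1, 1 <= c2, 1 <= c3 &
  forall
    (* the network G : R^(w 0) -> R^(w n), i.e. k = w 0 and d = w n *)
    (n : nat) (w : nat -> nat) (W : forall i, 'M[R]_(w i.+1, w i))
    (n_gt0 : (0 < n)%N) (n_lt_d : (n < w n)%N)
    (widths : forall i, (1 <= i <= n)%N -> (w i <= w n)%N)
    (* the generic triple (a, xi, tau); rho is the radius written R informally *)
    (rho lambda : R) (rho_ge1 : 1 <= rho) (lambda_gt0 : 0 < lambda)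
    (d0 : measure_display) (T0 : measurableType d0) (P0 : probability T0 R)
    (a : {RV P0 >-> (w n).-tuple R}) (xi tau : {RV P0 >-> R})
    (a_mean : mean_zero P0 a) (a_iso : isotropic P0 a)
    (a_subexp : subexponential_vec P0 a) (xi_subexp : subexponential P0 xi)
    (tau_unif : forall S : set R, measurable S ->
       distribution P0 tau S = uniform_prob (gtrN lambda_gt0) S)
    (indep : mutually_independent P0
       (tnth [tuple sigma_of a; sigma_of xi; sigma_of tau]))
    (* the i.i.d. sample *)
    (m : nat) (m_gt0 : (0 < m)%N)
    (d1 : measure_display) (T : measurableType d1) (P : probability T R)
    (as_ : 'I_m -> {RV P >-> (w n).-tuple R}) (xis taus : 'I_m -> {RV P >-> R})
    (copies : forall i,
       same_law P P0 (triple (as_ i) (xis i) (taus i)) (triple a xi tau))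
    (sample_indep : mutually_independent P
       (fun i => sigma_of (triple (as_ i) (xis i) (taus i))))
    (eps u : R) (eps_gt0 : 0 < eps) (eps_lt1 : eps < 1) (u_ge0 : 0 <= u),
  let G := relu_net W n in
  let k := (w 0%N)%:R : R in
  let d := (w n)%:R : R in
  let C := Num.max
    (c1 * (rho * fine (psi1_norm_vec P0 a) + fine (psi1_norm P0 xi))) 1 in
  lambda >= 4 * C * ln (64 * C * eps^-1) ->
  m%:R >= c2 * lambda ^+ 2 * ln (lambda * m%:R) ^+ 2 *
          (k * n%:R * ln (expR 1 * d) + k * ln (2 * rho) + k * ln m%:R + u)
          / eps ^+ 2 ->
  with_probability_at_least P (1 - c3 * expR (- u))
    [set omega | forall x0 : 'cV[R]_(w 0%N), norm2 (G x0) <= rho ->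
       let a_ i := vec (as_ i omega) in
       let y i := one_bit (a_ i) (xis i omega) (taus i omega) (G x0) in
       forall xhat : 'cV[R]_(w 0%N),
         is_minimizer (empirical_risk G lambda a_ y) xhat ->
         norm2 (G xhat - G x0) <= eps]].
Proof.
(* The constants come from [moment_budget], [sample_size_budget] and the three bad events per net
   pair. *)
exists 128, (1024 * 1024), 3; split; try lra.
move=> n w W n_gt0 n_lt_d widths rho lambda rho_ge1 lambda_gt0 d0 T0 P0 a xi tau
  a_mean a_iso a_subexp xi_subexp tau_unif indep m m_gt0 d1 T P as_ xis taus copies
  sample_indep eps u eps_gt0 eps_lt1 u_ge0 G k d C HC Hm.
(* For k = 0 the domain is a single point; [complexity_ge1] below needs k > 0. *)
have [k0|k_gt0] := posnP (w 0%N).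
  exists setT; last first.
    rewrite probability_setT lee_fin gerBl.
    by apply: mulr_ge0; [lra|exact: expR_ge0].
  split => // omega _ x0 _ a_ y xhat _.
  have -> : xhat = x0.
    apply/colP => i.
    by have : (i < 0)%N by rewrite -[X in (_ < X)%N]k0 ltn_ord.
  by rewrite subrr norm20 ltW.
have d_gt0 : (0 < w n)%N by apply: leq_trans n_lt_d.
have d_ge2 : (2 <= w n)%N by apply: leq_ltn_trans n_lt_d.
have rho_gt0 : 0 < rho by apply: lt_le_trans rho_ge1.
pose K := fine (psi1_norm_vec P0 a); pose Kx := fine (psi1_norm P0 xi).
have KE : psi1_norm_vec P0 a = K%:E.
  by rewrite fineK // ge0_fin_numE // psi1_norm_vec_ge0.
have KxE : psi1_norm P0 xi = Kx%:E.
  by rewrite fineK // ge0_fin_numE // psi1_norm_ge0.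
have K0 : 0 <= K by rewrite -lee_fin -KE psi1_norm_vec_ge0.
have Kx0 : 0 <= Kx by rewrite -lee_fin -KxE psi1_norm_ge0.
have C_ge1 : 1 <= C by rewrite /C le_max lexx orbT.
have C_geK : 128 * (rho * K + Kx) <= C by rewrite /C le_max lexx.
clearbody C.
have [C_le lambda4 tail] := tail_budget C_ge1 eps_gt0 eps_lt1 HC.
have [b_gt0 b_le lambda_ge1 dot_exp signal_exp] :=
  moment_budget C_ge1 C_geK rho_ge1 K0 Kx0 KE KxE C_le lambda4.
clear HC C_geK.
pose B := complexity (w 0%N) n (w n) m rho u.
have B_ge1 : 1 <= B by exact: complexity_ge1.
have m_ge1 : 1 <= m%:R :> R by rewrite ler1n.
have d_ge1 : 1 <= d by rewrite ler1n.
have c2_ge0 := mulr_ge0 (ler0n R 1024) (ler0n R 1024).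
have {}Hm := effective_sample_size c2_ge0 lambda4 m_ge1 eps_gt0 B_ge1 Hm.
have [de_eps de_m L_le F_le] := sample_size_budget eps_gt0 eps_lt1 b_gt0 b_le
  lambda_ge1 B_ge1 (lt_le_trans ltr01 m_ge1) d_ge1 Hm.
clear Hm c2_ge0; set delta := (m%:R * d)^-1 in de_eps de_m.
have de_gt0 : 0 < delta.
  by rewrite invr_gt0 mulr_gt0 //; [exact: lt_le_trans m_ge1|exact: lt_le_trans d_ge1].
have de_le1 : delta <= 1.
  by apply: le_trans de_eps _; rewrite ler_pdivrMr // mul1r (le_trans (ltW eps_lt1)) // ler1n.
have [s [szs sP sG]] := network_nets W widths d_gt0 rho_ge1 de_gt0 de_le1.
have [A mA [PA HA]] := net_bound a_mean a_iso tau_unif indep b_gt0 b_le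
  dot_exp signal_exp (ltW rho_gt0) eps_gt0 eps_lt1 lambda_ge1 tail d_ge2 m_gt0 copies
  sample_indep sP (ltW de_gt0) de_m L_le.
exists (~` A).
  split; first exact: measurableC.
  move=> omega nA x0 x0rho a_ y xhat Hmin.
  have [A1 [A0 [g [s' [G0 G1 gd net gs]]]]] := sG x0 xhat x0rho.
  apply: (minimizer_error (ltW lambda_gt0) G0 G1 gd de_eps net _ Hmin) => h /gs ghs.
  have [h1 h2] := HA _ nA _ ghs.
  (* Deviation and flips get half of the threshold each. *)
  have -> : eps / 8 = eps / 16 + eps / 16 by field.
  apply: lerD h1 _; apply: le_trans F_le; apply: ler_wpM2l h2.
  by rewrite divr_ge0 ?mulr_ge0 // ltW.
rewrite probability_setC // EFinB leeB //; apply: le_trans PA _.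
rewrite lee_fin mulrCA ler_wpM2l //.
(* The net has at most exp(8 (B - u)) pairs and each fails with probability at most 3 exp(-8 B),
   which leaves 3 exp(-8 u) <= 3 exp(-u). *)
have := net_count (w 0%N) u n_gt0 d_ge2 m_gt0 rho_ge1.
move=> /(le_trans szs)/(ler_wpM2r (expR_ge0 (- (8 * B))))/le_trans; apply.
rewrite -expRD ler_expR -/B; clear -u_ge0; clearbody B; lra.
Qed.
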